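(* For every $\varepsilon > 0$ there exist a constant $\delta > 0$ and an integer $k_0$ such that the following holds. Let $k \ge k_0$ be an integer, let $\mathcal{H}$ be a good family of graphs, and let $G$ be a finite $\mathcal{H}$-free graph with minimum degree at least $k$. If $p \in [0,1]$ satisfies $p \ge \frac{1+\varepsilon}{k}$, then \[ \Pr\big(G_p \text{ contains a cycle of length at least } n_{\mathcal{H}}(\delta k)\big) \ge 1 - \exp(-\delta k). \]
   Context: All graphs are finite and simple. A family $\mathcal{H}$ of graphs is called good if it is a finite (possibly empty) collection of connected graphs, each of which contains a cycle. A graph $G$ is $\mathcal{H}$-free if it contains no copy of any $H \in \mathcal{H}$ as a (not necessarily induced) subgraph. For a real number $d>0$, $n_{\mathcal{H}}(d)$ denotes the smallest number of vertices of an $\mathcal{H}$-free graph with average degree at least $d$ (equivalently, the smallest $n$ with $nd \le 2\,\mathrm{ex}(n,\mathcal{H})$, where $\mathrm{ex}(n,\mathcal{H})$ is the maximum number of edges in an $\mathcal{H}$-free graph on $n$ vertices). For a graph $G$ and $p \in [0,1]$, $G_p$ is the random spanning subgraph of $G$ obtained by keeping each edge of $G$ independently with probability $p$. *)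

(* Defs.v *)
From HB Require Import structures.
From Stdlib Require List.
From mathcomp Require Import all_boot all_order all_algebra.
From mathcomp Require Import all_classical all_reals all_analysis.

Set Implicit Arguments.
Unset Strict Implicit.
Unset Printing Implicit Defensive.

Import Order.TTheory GRing.Theory Num.Theory.
Local Open Scope ring_scope.

Record sgraph := SGraph {
  vertex :> finType;
  adj : rel vertex;
  adj_sym : symmetric adj;
  adj_irrefl : irreflexive adj
}.

Definition edges (G : sgraph) : {set {set G}} :=
  [set [set u.1; u.2]%SET | u : G * G & adj u.1 u.2]%SET.

Definition degree (G : sgraph) (x : G) : nat := #|[set y | adj x y]%SET|.

Definition average_degree (R : realType) (G : sgraph) : R :=
  (\sum_(x : G) degree x)%:R / #|G|%:R.

(* Graphs are not required to have a vertex; without one there is no minimum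
   degree. *)
Definition min_degree_ge (G : sgraph) (k : nat) : Prop :=
  (0 < #|G|)%N /\ forall x : G, (k <= degree x)%N.

(* The bound on the length excludes the degenerate [ucycle]s consisting of no
   vertex or of one edge traversed back and forth. *)
Definition is_cycle (G : sgraph) (c : seq G) : Prop :=
  ucycle (@adj G) c /\ (3 <= size c)%N.

Definition has_cycle_ge (n : nat) (G : sgraph) : Prop :=
  exists2 c : seq G, is_cycle c & (n <= size c)%N.

Definition connected_graph (G : sgraph) : Prop :=
  (0 < #|G|)%N /\ forall x y : G, connect (@adj G) x y.

Definition contains_copy (G H : sgraph) : Prop :=
  exists2 f : H -> G, injective f & forall x y : H, adj x y -> adj (f x) (f y).

Definition good_family (HH : seq sgraph) : Prop :=
  forall H, List.In H HH -> connected_graph H /\ exists c : seq H, is_cycle c.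

Definition graph_free (HH : seq sgraph) (G : sgraph) : Prop :=
  forall H, List.In H HH -> ~ contains_copy G H.

Definition dense_free_order (R : realType) (HH : seq sgraph) (d : R)
    (n : nat) : Prop :=
  exists G : sgraph,
    [/\ #|G| = n, (0 < n)%N, graph_free HH G & d <= average_degree R G].

(* For a good family the default value 0 is never taken: every member contains
   a cycle, so a graph of large average degree and large girth is free. *)
Definition n_free (R : realType) (HH : seq sgraph) (d : R) : nat :=
  match pselect (exists n, `[< dense_free_order HH d n >]) with
  | left ex_n => ex_minn ex_n
  | right _ => 0%N
  end.

Lemma n_freeP (R : realType) (HH : seq sgraph) (d : R) (m : nat) :
  dense_free_order HH d m ->
  dense_free_order HH d (n_free HH d) /\ (n_free HH d <= m)%N.
Proof.
move=> hm; rewrite /n_free; case: pselect => [ex_n|[]]; last first.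
  by exists m; apply/asboolP.
case: ex_minnP => n /asboolP hn min_n; split=> //.
by apply: min_n; apply/asboolP.
Qed.

Section SpanningSubgraph.
Variables (G : sgraph) (F : {set {set G}}).

Definition spanning_adj : rel G :=
  fun x y => adj x y && ([set x; y]%SET \in F).

Lemma spanning_adj_sym : symmetric spanning_adj.
Proof. by move=> x y; rewrite /spanning_adj adj_sym finset.setUC. Qed.

Lemma spanning_adj_irrefl : irreflexive spanning_adj.
Proof. by move=> x; rewrite /spanning_adj adj_irrefl. Qed.

Definition spanning_subgraph : sgraph :=
  SGraph spanning_adj_sym spanning_adj_irrefl.

End SpanningSubgraph.

(* The product of Bernoulli(p) laws over the edges of G, at the outcome in which
   F is the set of edges kept. *)
Definition edge_weight (R : realType) (G : sgraph) (p : R)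
    (F : {set {set G}}) : R :=
  \prod_(e in edges G) (if e \in F then p else 1 - p).

Definition prob_percolation (R : realType) (G : sgraph) (p : R)
    (P : sgraph -> Prop) : R :=
  \sum_(F in powerset (edges G) | `[< P (spanning_subgraph F) >])
    edge_weight p F.

(* Main.v *)
(* Write m for the number of edges of G and l for n_H(delta k); we may assume
   p = (1 + eps) / k with eps <= 1. The excess of a graph F is its number of
   edges in excess of a spanning forest.

   The excess of G_p is at least c p m, for some c = c(eps), outside an event of
   probability exp(- c' k). For its mean, expose G_p in two rounds. After the
   first one, with p1 = (1 + eps / 2) / k, exploration from a vertex shows that
   it lies in a component of at least K vertices with probability at least
   eps / 5. By Harris' inequality a constant fraction of the edges of G have both
   ends in such components. There are at most |G| / K of these components, so all
   but |G| / K of the edges inside them that are added in the second round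
   increase the excess. The excess is monotone and 1-Lipschitz in each edge, hence
   concentrated.

   If F has no cycle of length at least l, take a depth-first search forest T of
   F: every edge of F outside T joins a vertex to one of its l closest ancestors.
   By the definition of n_H, every set S of at most 3 l vertices of G spans few
   edges, O(delta k |S|), and cutting T into pieces of about l vertices shows that
   at most O(delta m) edges of G are of this form. The excess of F, being the
   number of edges outside T, is then at most O(delta p m) up to an exponentially
   small probability, which is summed over T without a union bound since T, as a
   set of edges, determines the possible places of the other edges. For small
   delta this contradicts the first part. *)

Require Import Defs.
From HB Require Import structures.
From mathcomp Require Import all_boot all_order all_algebra.
From mathcomp Require Import all_classical all_reals all_analysis.
From mathcomp Require Import ring lra zify.
(* [all_classical] shadows the names of the finite set theory. *)
Import mathcomp.boot.fintype mathcomp.boot.finset.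

Set Implicit Arguments.
Unset Strict Implicit.
Unset Printing Implicit Defensive.

Import Order.TTheory GRing.Theory Num.Theory.
Local Open Scope ring_scope.

(** * Random subsets *)

Lemma setU1_ind (T : finType) (P : {set T} -> Prop) :
    P set0 ->
    (forall (e : T) (E : {set T}), e \notin E -> P E -> P (e |: E)) ->
  forall E, P E.
Proof.
move=> P0 PU E; have [n] := ubnP #|E|; elim: n E => // n IH E ltEn.
have [->//|[e eE]] := set_0Vmem E.
rewrite -(setD1K eE); apply: PU; first by rewrite !inE eqxx.
by apply: IH; rewrite (cardsD1 e E) eE in ltEn.
Qed.

Section Expectation.
Variables (R : realType) (T : finType).
Implicit Types (p q : R) (E F A B : {set T}) (f g : {set T} -> R).

Definition subset_weight p E F : R :=
  \prod_(e in E) (if e \in F then p else 1 - p).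

Definition expectation p E f : R :=
  \sum_(F in powerset E) subset_weight p E F * f F.

Lemma subset_weight_ge0 p E F : 0 <= p <= 1 -> 0 <= subset_weight p E F.
Proof.
move=> /andP[p0 p1]; apply: prodr_ge0 => e _.
by case: ifP; rewrite // subr_ge0.
Qed.

Lemma eq_expectation p E f g :
  (forall F, F \subset E -> f F = g F) -> expectation p E f = expectation p E g.
Proof. by move=> fg; apply: eq_bigr => F; rewrite inE => /fg->. Qed.

Lemma expectation_set0 p f : expectation p set0 f = f set0.
Proof.
rewrite /expectation powerset0 big_set1 /subset_weight big1 ?mul1r// => e.
by rewrite inE.
Qed.

(** Conditioning on whether [e] is kept; most facts below follow from this by induction on [E]. *)
Lemma expectationU1 p e E f : e \notin E ->
  expectation p (e |: E) f =
    p * expectation p E (fun F => f (e |: F)) + (1 - p) * expectation p E f.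
Proof.
move=> eE; rewrite /expectation (bigID (fun F : {set T} => e \in F)) /=.
congr (_ + _).
  rewrite (reindex_onto (fun F => e |: F) (fun F => F :\ e)) /=; last first.
    by move=> F /andP[_ eF]; rewrite setD1K.
  rewrite big_distrr /=; apply: eq_big => F; last first.
    rewrite !inE eqxx /= andbT => /andP[FE /eqP FeK].
    have eF : e \notin F by rewrite -FeK !inE eqxx.
    rewrite mulrA; congr (_ * _); rewrite /subset_weight big_setU1//=.
    rewrite !inE eqxx /=; congr (_ * _); apply: eq_bigr => x xE.
    by rewrite !inE; case: eqVneq => // xe; rewrite xe (negPf eE) in xE.
  rewrite !inE eqxx /= andbT; apply/andP/idP.
    move=> [FE /eqP FeK]; have eF : e \notin F by rewrite -FeK !inE eqxx.
    by move/(setSD [set e]): FE; rewrite FeK setU1K.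
  move=> FE; split; first exact: setUS.
  by rewrite setU1K//; apply: contra eE => eF; apply: (subsetP FE).
rewrite big_distrr /=; apply: eq_big => F.
  rewrite !inE; apply/andP/idP => [[FE eF]|FE].
    by apply/subsetP => x xF; move/subsetP: FE => /(_ _ xF); rewrite !inE;
      case: eqVneq => // xe; rewrite -xe xF in eF.
  split; first exact: subset_trans FE (subsetUr _ _).
  by apply: contra eE => eF; apply: (subsetP FE).
rewrite !inE => /andP[FE eF]; rewrite mulrA; congr (_ * _).
by rewrite /subset_weight big_setU1//= (negPf eF).
Qed.

Lemma expectation_cst p E (c : R) : expectation p E (fun=> c) = c.
Proof.
elim/setU1_ind: E => [|e E eE IH]; first by rewrite expectation_set0.
by rewrite expectationU1// IH; ring.
Qed.

Lemma expectationD p E f g :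
  expectation p E (fun F => f F + g F) = expectation p E f + expectation p E g.
Proof. by rewrite -big_split; apply: eq_bigr => F _; rewrite mulrDr. Qed.

Lemma expectationZ p E (c : R) f :
  expectation p E (fun F => c * f F) = c * expectation p E f.
Proof. by rewrite big_distrr; apply: eq_bigr => F _; rewrite mulrCA. Qed.

Lemma expectationB p E f g :
  expectation p E (fun F => f F - g F) = expectation p E f - expectation p E g.
Proof.
rewrite -[- expectation _ _ g]mulN1r -expectationZ -expectationD.
by apply: eq_expectation => F _; rewrite mulN1r.
Qed.

Lemma expectation_sum p E (I : finType) (P : pred I) (f : I -> {set T} -> R) :
  expectation p E (fun F => \sum_(i | P i) f i F) =
    \sum_(i | P i) expectation p E (f i).
Proof.
by rewrite /expectation exchange_big; apply: eq_bigr => F _; rewrite big_distrr.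
Qed.

Lemma ler_expectation p E f g : 0 <= p <= 1 ->
  (forall F, F \subset E -> f F <= g F) ->
  expectation p E f <= expectation p E g.
Proof.
move=> p01 fg; apply: ler_sum => F; rewrite inE => /fg fgF.
by rewrite ler_wpM2l// subset_weight_ge0.
Qed.

Lemma expectationU p A B f : [disjoint A & B] ->
  expectation p (A :|: B) f =
    expectation p A (fun F1 => expectation p B (fun F2 => f (F1 :|: F2))).
Proof.
elim/setU1_ind: A f => [|e A eA IH] f AB.
  rewrite expectation_set0 set0U; apply: eq_expectation => F _.
  by rewrite set0U.
have eB : e \notin B by rewrite (disjointFr AB) ?setU11.
have {}AB : [disjoint A & B].
  by apply: disjointWl AB; apply: subsetUr.
rewrite -setUA !expectationU1 ?inE ?negb_or ?eA// !IH//.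
congr (_ * _ + _); apply: eq_expectation => F1 _.
by apply: eq_expectation => F2 _; rewrite setUA.
Qed.

(** The union of two independent random subsets misses each element with probability
    [(1 - p) * (1 - q)], independently of the others. *)
Lemma expectation_sprinkle p q E f :
  expectation (1 - (1 - p) * (1 - q)) E f =
    expectation p E (fun F1 => expectation q E (fun F2 => f (F1 :|: F2))).
Proof.
elim/setU1_ind: E f => [|e E eE IH] f; first by rewrite !expectation_set0 setU0.
rewrite !expectationU1// !IH.
set X := expectation p E _; set Y := expectation p E _.
have -> : expectation p E (fun F1 => expectation q (e |: E)
    (fun F2 => f (e |: F1 :|: F2))) = X.
  apply: eq_expectation => F1 _; rewrite expectationU1//.
  have -> : (fun F2 => f (e |: F1 :|: (e |: F2))) =
            (fun F2 => f (e |: (F1 :|: F2))).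
    by apply/funext => F2; rewrite setUACA setUid.
  under [X in _ + _ * X]eq_expectation => F2 _ do rewrite -setUA.
  ring.
have -> : expectation p E (fun F1 => expectation q (e |: E)
    (fun F2 => f (F1 :|: F2))) = q * X + (1 - q) * Y.
  rewrite -!expectationZ -expectationD; apply: eq_expectation => F1 _.
  rewrite expectationU1//; congr (_ * _ + _).
  by apply: eq_expectation => F2 _; rewrite setUCA.
ring.
Qed.

Lemma expectation_monotone p q E f : 0 <= p <= q -> q <= 1 ->
  (forall F F', F \subset F' -> F' \subset E -> f F <= f F') ->
  expectation p E f <= expectation q E f.
Proof.
move=> /andP[p0 pq] q1 fle; have [p1|p1] := eqVneq p 1.
  by have -> : q = p by lra.
have p1' : p < 1 by rewrite lt_neqAle p1; lra.
(* Coupling: a second round of probability [r] turns [p] into [q], as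
   [1 - q = (1 - p) * (1 - r)]. *)
pose r := (q - p) / (1 - p).
have r01 : 0 <= r <= 1.
  rewrite divr_ge0 ?subr_ge0//=; last exact: ltW.
  by rewrite ler_pdivrMr ?subr_gt0//; lra.
have -> : q = 1 - (1 - p) * (1 - r).
  by rewrite /r; field; rewrite subr_eq0 eq_sym.
rewrite expectation_sprinkle; apply: ler_expectation; first lra.
move=> F1 F1E; rewrite -[leLHS](expectation_cst r E).
apply: ler_expectation => // F2 F2E.
by apply: fle; rewrite ?subsetUl// subUset F1E.
Qed.

(** Induction on [E]: the conditional means of [f] and [g] both increase when [e] is added, hence
    are nonnegatively correlated. *)
Lemma harris p E f g : 0 <= p <= 1 ->
    (forall F F', F \subset F' -> f F <= f F') ->
    (forall F F', F \subset F' -> g F <= g F') ->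
  expectation p E f * expectation p E g
    <= expectation p E (fun F => f F * g F).
Proof.
move=> p01; elim/setU1_ind: E f g => [|e E eE IH] f g fle gle.
  by rewrite !expectation_set0.
rewrite !expectationU1//.
have IH1 := IH (fun F => f (e |: F)) (fun F => g (e |: F))
  (fun F F' sF => fle _ _ (setUS _ sF)) (fun F F' sF => gle _ _ (setUS _ sF)).
have IH0 := IH f g fle gle.
have lef : expectation p E f <= expectation p E (fun F => f (e |: F)).
  by apply: ler_expectation => // F _; apply: fle; apply: subsetUr.
have leg : expectation p E g <= expectation p E (fun F => g (e |: F)).
  by apply: ler_expectation => // F _; apply: gle; apply: subsetUr.
move: lef leg IH0 IH1.
set a0 := expectation p E f; set b0 := expectation p E g.
set a1 := expectation p E _; set b1 := expectation p E _.
set c0 := expectation p E _; set c1 := expectation p E _.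
move=> lef leg IH0 IH1.
(* This is the covariance of the two conditional means. *)
have : 0 <= p * (1 - p) * ((a1 - a0) * (b1 - b0)).
  by rewrite mulr_ge0 ?mulr_ge0 ?subr_ge0//; lra.
have : p * (a1 * b1) <= p * c1 by apply: ler_wpM2l => //; lra.
have : (1 - p) * (a0 * b0) <= (1 - p) * c0 by apply: ler_wpM2l => //; lra.
nra.
Qed.

(** The generating function of a binomial variable. *)
Lemma expectation_expr_cards p E B (z : R) :
  expectation p E (fun F => z ^+ #|F :&: B|) = (1 - p + p * z) ^+ #|E :&: B|.
Proof.
elim/setU1_ind: E => [|e E eE IH].
  by rewrite expectation_set0 set0I cards0 !expr0.
rewrite expectationU1// IH.
have [eB|eB] := boolP (e \in B).
  have cardU F : F \subset E -> #|(e |: F) :&: B| = #|F :&: B|.+1.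
    move=> FE; rewrite setIUl (setIidPl _) ?sub1set// cardsU1 inE.
    by rewrite (negPf (contra (subsetP FE e) eE)).
  under eq_expectation => F FE do rewrite cardU// exprS.
  by rewrite expectationZ IH cardU// exprS; ring.
have cardU F : (e |: F) :&: B = F :&: B.
  by rewrite setIUl (_ : [set e] :&: B = set0) ?set0U//; apply/setP => x;
    rewrite !inE; case: eqVneq => // ->; rewrite (negPf eB).
under eq_expectation => F _ do rewrite cardU.
by rewrite IH cardU; ring.
Qed.

Lemma expectation_cards p E B :
  expectation p E (fun F => #|F :&: B|%:R) = p * #|E :&: B|%:R.
Proof.
elim/setU1_ind: E => [|e E eE IH].
  by rewrite expectation_set0 set0I cards0 mulr0.
rewrite expectationU1// IH.
have [eB|eB] := boolP (e \in B).
  have cardU F : F \subset E -> #|(e |: F) :&: B| = #|F :&: B|.+1.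
    move=> FE; rewrite setIUl (setIidPl _) ?sub1set// cardsU1 inE.
    by rewrite (negPf (contra (subsetP FE e) eE)).
  under eq_expectation => F FE do rewrite cardU// -natr1.
  by rewrite expectationD IH expectation_cst cardU// -natr1; ring.
have cardU F : (e |: F) :&: B = F :&: B.
  by rewrite setIUl (_ : [set e] :&: B = set0) ?set0U//; apply/setP => x;
    rewrite !inE; case: eqVneq => // ->; rewrite (negPf eB).
under eq_expectation => F _ do rewrite cardU.
by rewrite IH cardU; ring.
Qed.

(** Because [(1 + x) * (1 - x + x ^+ 2) = 1 + x ^+ 3 >= 1] and [1 + x <= expR x]. *)
Lemma expRN_le_quadratic (x : R) : 0 <= x -> expR (- x) <= 1 - x + x ^+ 2.
Proof.
move=> x0; have := expR_ge1Dx x; rewrite expRN => e1.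
rewrite -[leRHS]invrK lef_pV2 ?posrE ?expR_gt0//; last first.
  by rewrite invr_gt0; nra.
apply: le_trans e1; rewrite -[leRHS]invrK lef_pV2 ?posrE ?invr_gt0; [|nra..].
by rewrite -[X in X <= _]div1r ler_pdivrMr; nra.
Qed.

(** Conditioning on one element at a time: the two conditional means differ by some [d] in [[0, 1]],
    which costs a factor [p * expR (- (t * d)) + (1 - p)]. The error term has [p * #|E|] and not
    [#|E|], which is essential for small [p]. *)
Lemma laplace_lipschitz p E f (t : R) : 0 <= p <= 1 -> 0 <= t ->
    (forall F e, f F <= f (e |: F) <= f F + 1) ->
  expectation p E (fun F => expR (- (t * f F)))
    <= expR (- (t * expectation p E f) + t ^+ 2 * (p * #|E|%:R)).
Proof.
move=> p01 t0; elim/setU1_ind: E f => [|e E eE IH] f fL.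
  by rewrite !expectation_set0 cards0 !mulr0 addr0.
rewrite !expectationU1// cardsU1 eE.
have IH0 := IH f fL.
have /IH IH1 : forall F e', f (e |: F) <= f (e |: (e' |: F)) <= f (e |: F) + 1.
  by move=> F e'; rewrite setUCA; apply: fL.
set a0 := expectation p E f in IH0 *.
set a1 := expectation p E (fun F => f (e |: F)) in IH1 *.
have ad : 0 <= a1 - a0 <= 1.
  rewrite subr_ge0 lerBlDl; apply/andP; split.
    by apply: ler_expectation => // F _; have /andP[] := fL F e.
  rewrite -[1](expectation_cst p E) -expectationD.
  by apply: ler_expectation => // F _; have /andP[] := fL F e.
set d := a1 - a0 in ad; have a1E : a1 = a0 + d by rewrite /d; ring.
set c := t ^+ 2 * (p * #|E|%:R) in IH0 IH1.
apply: (@le_trans _ _ (p * expR (- (t * a1) + c) + (1 - p) * expR (- (t * a0) + c))).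
  by apply: lerD; apply: ler_wpM2l => //; lra.
have -> : - (t * (p * a1 + (1 - p) * a0)) + t ^+ 2 * (p * (true + #|E|)%:R) =
          (- (t * a0) + c) + (- (t * p * d) + t ^+ 2 * p).
  by rewrite a1E /c natrD /=; ring.
have -> : - (t * a1) + c = (- (t * a0) + c) + - (t * d) by rewrite a1E; ring.
rewrite !expRD -/c; set X := expR _ * expR c.
have X0 : 0 < X by rewrite mulr_gt0 ?expR_gt0.
rewrite -expRD.
apply: (@le_trans _ _ (X * (p * expR (- (t * d)) + (1 - p)))); first by lra.
rewrite ler_pM2l//; apply: le_trans (expR_ge1Dx _).
have td : 0 <= t * d by rewrite mulr_ge0; lra.
have : p * expR (- (t * d)) <= p * (1 - t * d + (t * d) ^+ 2).
  by apply: ler_wpM2l; [lra | apply: expRN_le_quadratic].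
have : p * (t * d) ^+ 2 <= p * t ^+ 2.
  apply: ler_wpM2l; first lra.
  by rewrite exprMn ler_piMr ?sqr_ge0// expr2; nra.
lra.
Qed.

End Expectation.

(** * Components and excess *)

Lemma connect_invariant (T : finType) (e : rel T) (P : T -> Prop) (x y : T) :
    P x -> (forall z z', P z -> e z z' -> P z') ->
  connect e x y -> P y.
Proof.
move=> Px Pe /connectP[p + ->].
elim: p x Px => [|z p IH] x Px //= /andP[xz]; apply: IH.
exact: Pe xz.
Qed.

Section Components.
Variable G : sgraph.
Implicit Types (F H : {set {set G}}) (x y u v : G) (K : nat).

Let conn F := connect (@spanning_adj G F).

Lemma spanning_adjW F F' : F \subset F' ->
  subrel (@spanning_adj G F) (@spanning_adj G F').
Proof.
by move=> /subsetP sF x y /andP[xy xyF]; rewrite /spanning_adj xy sF.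
Qed.

Lemma connect_spanningW F F' : F \subset F' ->
  subrel (connect (@spanning_adj G F)) (connect (@spanning_adj G F')).
Proof.
move=> sF; apply: connect_sub => x y xy; apply: connect1.
exact: spanning_adjW xy.
Qed.

Lemma connect_spanning_sym F : connect_sym (@spanning_adj G F).
Proof. exact/sym_connect_sym/spanning_adj_sym. Qed.

Definition component F x : {set G} := [set y | connect (@spanning_adj G F) x y].

(* The index of [x] is the least in its component, so that counting such
   vertices counts the components. *)
Definition minimal F x : bool :=
  [forall y in component F x, (enum_rank x <= enum_rank y)%N].

Definition ncomponents F : nat := #|[set x | minimal F x]|.

Definition large K F : {set G} := [set x | (K <= #|component F x|)%N].

Lemma minimalP F x :
  reflect (forall y, connect (@spanning_adj G F) x y ->
             (enum_rank x <= enum_rank y)%N)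
          (minimal F x).
Proof.
apply: (iffP forall_inP) => xmin y; first by move=> xy; apply: xmin; rewrite inE.
by rewrite inE; apply: xmin.
Qed.

Lemma minimalW F F' x : F \subset F' -> minimal F' x -> minimal F x.
Proof.
move=> sF /minimalP xmin; apply/minimalP => y xy; apply: xmin.
exact: connect_spanningW xy.
Qed.

Lemma component_eq F x y :
  connect (@spanning_adj G F) x y -> component F x = component F y.
Proof.
move=> xy; apply/setP => z; rewrite !inE.
exact: (same_connect (connect_spanning_sym F)).
Qed.

Lemma minimal_inj F x y :
  minimal F x -> minimal F y -> connect (@spanning_adj G F) x y -> x = y.
Proof.
move=> /minimalP xmin /minimalP ymin xy; apply/enum_rank_inj/val_inj/eqP => /=.
by rewrite eqn_leq xmin// ymin// connect_spanning_sym.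
Qed.

Lemma ncomponentsW F F' : F \subset F' -> (ncomponents F' <= ncomponents F)%N.
Proof.
move=> sF; apply: subset_leq_card; apply/subsetP => x; rewrite !inE.
exact: minimalW.
Qed.

Lemma connect_spanningU1 F u v x y :
    connect (@spanning_adj G ([set u; v] |: F)) x y ->
  conn F x y \/
  ((conn F x u \/ conn F x v) /\ (conn F u y \/ conn F v y)).
Proof.
apply: (connect_invariant (P := fun y => conn F x y \/ _)) => [|z z' Pz].
  by left; apply: connect0.
move=> /andP[zz']; rewrite !inE => /orP[/eqP zz'E|zz'F]; last first.
  have zz'1 : conn F z z' by apply: connect1; rewrite /spanning_adj zz'.
  case: Pz => [xz|[xuv [uz|vz]]]; first by left; apply: connect_trans zz'1.
    by right; split=> //; left; apply: connect_trans zz'1.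
  by right; split=> //; right; apply: connect_trans zz'1.
have /set2P z'uv : z' \in [set u; v] by rewrite -zz'E set22.
have /set2P zuv : z \in [set u; v] by rewrite -zz'E set21.
right; split; last first.
  by case: z'uv => ->; [left|right]; apply: connect0.
by case: Pz => [xz|[]//]; case: zuv => <-; [left|right].
Qed.

(** At most one vertex stops being minimal: two such vertices [x1], [x2] would both be linked to an
    end of the new edge, and to the same one, the other end being linked to a smaller vertex outside
    their components. *)
Lemma ncomponentsU1 F (e : {set G}) :
  (ncomponents F <= (ncomponents (e |: F)).+1)%N.
Proof.
have [/imsetP[[u v] /= _ ->]|ne] := boolP (e \in edges G); last first.
  apply: leqW; apply: subset_leq_card; apply/subsetP => x; rewrite !inE.
  move=> /minimalP xmin; apply/minimalP => y xy; apply: xmin.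
  apply: connect_sub xy => z z' /andP[zz'].
  rewrite !inE => /orP[/eqP ez|zz'F]; last first.
    by apply: connect1; rewrite /spanning_adj zz'.
  by case/negP: ne; apply/imsetP; exists (z, z'); rewrite ?inE.
set F' := _ |: F.
have sM : [set x | minimal F' x] \subset [set x | minimal F x].
  by apply/subsetP => x; rewrite !inE; apply: minimalW; apply: subsetUr.
rewrite /ncomponents -(cardsID [set x | minimal F' x]) (setIidPr sM) -addn1.
rewrite leq_add2l; apply/card_le1_eqP => x1 x2; rewrite !inE.
(* With [x1] below [x2], the vertex [y1] that defeats [x1] is also below [x2], hence in neither of
   their components. *)
suff wlog12 : forall x1 x2, ~~ minimal F' x1 && minimal F x1 ->
    ~~ minimal F' x2 && minimal F x2 ->
    (enum_rank x1 <= enum_rank x2)%N -> x1 = x2.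
  move=> h1 h2; case/orP: (leq_total (enum_rank x1) (enum_rank x2)) => le.
    exact/esym/wlog12.
  exact: wlog12.
move=> {}x1 {}x2 /andP[nm1 m1] /andP[nm2 m2] le12.
have dichotomy x : ~~ minimal F' x -> minimal F x -> exists2 y,
    (enum_rank y < enum_rank x)%N &
    ((conn F x u \/ conn F x v) /\ (conn F u y \/ conn F v y)).
  rewrite /minimal => /forall_inPn[y]; rewrite inE -ltnNge => xy yx.
  move=> /minimalP xmin; exists y => //.
  have [/xmin|//] := connect_spanningU1 xy.
  by rewrite leqNgt yx.
have [y1 lt1 [x1uv y1uv]] := dichotomy _ nm1 m1.
have [y2 _ [x2uv _]] := dichotomy _ nm2 m2.
have csym a b : conn F a b = conn F b a by apply: connect_spanning_sym.
have y1x1 : ~ conn F x1 y1.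
  by move/minimalP: m1 => m1 /m1; rewrite leqNgt lt1.
have y1x2 : ~ conn F x2 y1.
  by move/minimalP: m2 => m2 /m2; rewrite leqNgt (leq_trans lt1 le12).
have tr a b c : conn F a b -> conn F b c -> conn F a c by apply: connect_trans.
suff : conn F x1 x2 by apply: minimal_inj.
by case: x1uv x2uv y1uv => [x1u|x1v] [x2u|x2v] [y1u|y1v];
  try solve [case: y1x1; apply: tr y1u => // | case: y1x1; apply: tr y1v => //
  | case: y1x2; apply: tr y1u => // | case: y1x2; apply: tr y1v => //];
  [apply: (tr _ u); rewrite // csym | apply: (tr _ v); rewrite // csym ].
Qed.

(** Edges of [H] touch large components only, so a small component of [F] remains a component. *)
Lemma minimal_not_large F H x K :
    (forall e, e \in H -> e \subset large K F) ->
    x \notin large K F -> minimal F x ->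
  minimal (F :|: H) x.
Proof.
move=> Hlarge xL /minimalP xmin; apply/minimalP => y xy; apply: xmin.
move: xy; apply: (connect_invariant (P := connect _ x)) => [|z z' xz].
  exact: connect0.
move=> /andP[zz']; rewrite inE => /orP[zz'F|/Hlarge /subsetP zz'L].
  by apply: connect_trans xz _; apply: connect1; rewrite /spanning_adj zz'.
have := zz'L z (set21 _ _); rewrite inE -(component_eq xz).
by rewrite inE in xL; rewrite (negPf xL).
Qed.

(** The components of distinct minimal vertices are disjoint. *)
Lemma card_minimal_large F K :
  (K * #|[set x in large K F | minimal F x]| <= #|G|)%N.
Proof.
set A := [set _ in _ | _].
have : (\sum_(x in A) #|component F x| <= #|G|)%N.
  under eq_bigr => x _ do rewrite -sum1_card.
  rewrite (exchange_big_dep predT)//= -sum1_card; apply: leq_sum => y _.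
  rewrite sum1_card; apply/card_le1_eqP => x1 x2.
  move=> /andP[]; rewrite !inE => /andP[_ m1] h1.
  move=> /andP[]; rewrite !inE => /andP[_ m2] h2.
  apply: (minimal_inj m2 m1); apply: connect_trans h2 _.
  by rewrite connect_spanning_sym.
apply: leq_trans; rewrite mulnC -sum_nat_const; apply: leq_sum => x.
by rewrite !inE => /andP[].
Qed.

End Components.

Section Excess.
Variables (R : realType) (G : sgraph).
Implicit Types (F H : {set {set G}}).

(** The cyclomatic number. A member of [F] that is no edge of [G] counts for one, so that the
    Lipschitz bounds hold for all sets. *)
Definition excess F : R := #|F|%:R + (ncomponents F)%:R - #|G|%:R.

Lemma excess_lipschitz F (e : {set G}) :
  excess F <= excess (e |: F) <= excess F + 1.
Proof.
have [eF|eF] := boolP (e \in F).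
  by rewrite (setUidPr _) ?sub1set// lexx lerDl ler01.
have : (ncomponents (e |: F))%:R <= (ncomponents F)%:R :> R.
  by rewrite ler_nat; apply: ncomponentsW; apply: subsetUr.
have : (ncomponents F)%:R <= (ncomponents (e |: F))%:R + 1 :> R.
  by rewrite natr1 ler_nat; apply: ncomponentsU1.
rewrite /excess cardsU1 eF natrD /=; lra.
Qed.

Lemma excessW F F' : F \subset F' -> excess F <= excess F'.
Proof.
move=> sF; have -> : F' = F :|: F' :\: F.
  by rewrite -{1}(setID F' F) (setIidPr sF).
elim/setU1_ind: (F' :\: F) => [|e E _ IH]; first by rewrite setU0.
rewrite setUCA; apply: le_trans IH _.
by have /andP[] := excess_lipschitz (F :|: E) e.
Qed.

Lemma excess_ge0 F : 0 <= excess F.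
Proof.
apply: le_trans (excessW (sub0set F)).
rewrite /excess cards0 add0r subr_ge0 ler_nat /ncomponents.
rewrite (_ : [set x | _] = [set: G]) ?cardsT//; apply/setP => x.
rewrite !inE; apply/minimalP => y.
apply: (connect_invariant (P := fun y => (enum_rank x <= enum_rank y)%N)) => //.
by move=> z z' _ /andP[_]; rewrite inE.
Qed.

(** A new edge raises the excess unless it merges components; only large components get merged, and
    there are at most [#|G| / K] of them. *)
Lemma excess_sprinkle K F H : (0 < K)%N ->
  #|H :&: [set e : {set G} | e \subset large K F] :\: F|%:R - #|G|%:R / K%:R
    <= excess (F :|: H).
Proof.
move=> K0; set Q := [set e : {set G} | _].
apply: le_trans (excessW (setUS F (subsetIl H Q))).
have -> : F :|: H :&: Q = F :|: (H :&: Q :\: F).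
  by apply/setP => e; rewrite !inE; case: (e \in F).
set H' := _ :\: F; rewrite /excess cardsU (_ : F :&: H' = set0); last first.
  by apply/setP => e; rewrite !inE; case: (e \in F).
rewrite cards0 subn0 natrD.
have : (ncomponents F)%:R <=
    (ncomponents (F :|: H'))%:R + #|[set x in large K F | minimal F x]|%:R :> R.
  rewrite -natrD ler_nat /ncomponents.
  apply: leq_trans (leq_card_setU _ _).
  apply: subset_leq_card; apply/subsetP => x; rewrite !inE => mx.
  case: leqP => //= xK; first by rewrite mx orbT.
  rewrite orbF; apply: (@minimal_not_large _ _ _ _ K) mx.
    by move=> e; rewrite !inE => /andP[_ /andP[]].
  by rewrite inE -ltnNge.
have : #|[set x in large K F | minimal F x]|%:R <= #|G|%:R / K%:R :> R.
  rewrite ler_pdivlMr ?ltr0n// -natrM ler_nat mulnC.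
  exact: card_minimal_large.
have := excess_ge0 F; rewrite /excess; lra.
Qed.

End Excess.

(** * Exploration and sprinkling *)

Section Exploration.
Variables (R : realType) (G : sgraph).
Implicit Types (A D : {set G}) (E F : {set {set G}}) (p s : R).

Definition avoiding_adj D F : rel G :=
  fun u v => [&& u \notin D, v \notin D & @spanning_adj G F u v].

Definition reach F A D : {set G} :=
  [set y | [exists x in A, connect (avoiding_adj D F) x y]].

Lemma reachP F A D y :
  reflect (exists2 x, x \in A & connect (avoiding_adj D F) x y)
          (y \in reach F A D).
Proof. by rewrite inE; apply: exists_inP. Qed.

Lemma subset_reach F A D : A \subset reach F A D.
Proof. by apply/subsetP => x xA; apply/reachP; exists x. Qed.

Lemma reach_disjoint F A D : [disjoint A & D] -> [disjoint reach F A D & D].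
Proof.
move=> AD; apply/pred0P => y /=; apply/negbTE/andP => -[/reachP[x xA xy] yD].
have : y \notin D; last by rewrite yD.
move: xy; apply: (connect_invariant (P := fun y => y \notin D)).
  by rewrite (disjointFr AD xA).
by move=> z z' _ /and3P[].
Qed.

(* [D] is the set of explored vertices and [A] the set of active ones. When an
   active vertex is explored, it is replaced by the set [Y] of its new
   neighbours, and the mean of [(1 - s) ^+ #|Y|] is at most [1 - s]; hence the
   mean of [(1 - s) ^+ #|A|] does not increase. *)
Lemma exploration_fail (k K : nat) p s : 0 <= p <= 1 -> 0 <= s <= 1 ->
    (1 - p * s) ^+ (k - K) <= 1 - s ->
    (forall x : G, (k <= degree x)%N) ->
  forall D A E, [disjoint A & D] ->
    (forall u v : G, adj u v -> u \notin D -> v \notin D ->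
       [set u; v] \in E) ->
  expectation p E (fun F => (#|D| + #|reach F A D| < K)%N%:R)
    <= (1 - s) ^+ #|A|.
Proof.
move=> p01 s01 zk degk D; have [n] := ubnP (#|G| - #|D|).
elim: n D => // n IH D ltn A E AD ED.
have [A0|[x xA]] := set_0Vmem A.
  rewrite A0 cards0 expr0 -[leRHS](expectation_cst p E).
  by apply: ler_expectation => // F _; case: ltnP; rewrite /= ?ler01.
have [leK|ltK] := leqP K (#|D| + #|A|).
  rewrite (@eq_expectation _ _ _ _ _ (fun=> 0)).
    by rewrite expectation_cst exprn_ge0//; lra.
  move=> F _; rewrite ltnNge (leq_trans leK)// leq_add2l.
  exact/subset_leq_card/subset_reach.
have xD : x \notin D by rewrite (disjointFr AD xA).
(* [E1] is revealed now; [E2] still has all edges avoiding [x |: D], for the induction. *)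
pose E1 := [set e in E | x \in e]; pose E2 := E :\: E1.
have -> : E = E1 :|: E2.
  by rewrite /E2 -{1}(setID E E1) (setIidPr _)//; apply/subsetP => e;
    rewrite inE => /andP[].
have E12 : [disjoint E1 & E2].
  by rewrite -setI_eq0 /E2 setIDA setIC -setIDA setDv setI0.
rewrite expectationU//.
pose N := [set y | adj x y && (y \notin D :|: A)].
pose Y F1 := [set y in N | [set x; y] \in F1].
pose A' F1 := (A :\ x) :|: Y F1.
pose B : {set {set G}} := [set [set x; y] | y in N].
have edge_inj : {in N &, injective (fun y => [set x; y])}.
  move=> y z; rewrite !inE => /andP[xy _] _ eqyz.
  have : y \in [set x; z] by rewrite -eqyz set22.
  by case/set2P => // yx; rewrite yx adj_irrefl in xy.
have cardY F1 : #|Y F1| = #|F1 :&: B|.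
  have -> : F1 :&: B = [set [set x; y] | y in Y F1].
    apply/setP => e; rewrite inE; apply/andP/imsetP.
      by move=> [eF /imsetP[y yN eE]]; exists y => //; rewrite inE yN -eE.
    move=> [y]; rewrite inE => /andP[yN yF] ->; split=> //.
    by apply/imsetP; exists y.
  rewrite card_in_imset// => y z /[1!inE] /andP[yN _] /[1!inE] /andP[zN _].
  exact: edge_inj.
have cardA' F1 : #|A' F1| = (#|A|.-1 + #|F1 :&: B|)%N.
  rewrite /A' cardsU (_ : _ :&: _ = set0); last first.
    apply/setP => y; rewrite !inE; case: (y \in A); rewrite ?andbF//=.
    by rewrite orbT /= !andbF.
  by rewrite cards0 subn0 cardY (cardsD1 x A) xA.
have cardB : #|E1 :&: B| = #|N|.
  rewrite (setIidPr _) ?card_in_imset//; apply/subsetP => e /imsetP[y].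
  rewrite !inE negb_or => /andP[xy /andP[yD yA]] ->.
  by rewrite ED// set21.
have xD' F1 : [disjoint A' F1 & x |: D].
  rewrite -setI_eq0; apply/eqP/setP => y; rewrite !inE.
  case: eqVneq => [->|yx] /=; first by rewrite adj_irrefl.
  case yD: (y \in D); rewrite ?andbF//= andbT; apply/negbTE.
  by rewrite (disjointFl AD yD).
have inner F1 : F1 \subset E1 ->
    expectation p E2 (fun F2 => (#|D| + #|reach (F1 :|: F2) A D| < K)%N%:R)
      <= (1 - s) ^+ #|A|.-1 * (1 - s) ^+ #|F1 :&: B|.
  move=> F1E; rewrite -exprD -cardA'.
  apply: le_trans (IH (x |: D) _ (A' F1) E2 _ _); last first.
  - move=> u v uv; rewrite !inE !negb_or => /andP[ux uD] /andP[vx vD].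
    by rewrite ED//= eq_sym (negPf ux) eq_sym (negPf vx).
  - exact: xD'.
  - have : (#|x |: D| <= #|G|)%N by apply: max_card.
    by rewrite cardsU1 xD; clear -ltn; lia.
  apply: ler_expectation => // F2 _; rewrite ler_nat.
  suff lec : (#|x |: D| + #|reach F2 (A' F1) (x |: D)| <=
      #|D| + #|reach (F1 :|: F2) A D|)%N.
    by case: ltnP => // h; rewrite (leq_ltn_trans lec h).
  have xreach : x \notin reach F2 (A' F1) (x |: D).
    apply/negP => xr; have := disjointFr (reach_disjoint F2 (xD' F1)) xr.
    by rewrite setU11.
  suff : (#|x |: reach F2 (A' F1) (x |: D)| <= #|reach (F1 :|: F2) A D|)%N.
    by rewrite !cardsU1 xD xreach; clear; lia.
  apply: subset_leq_card; rewrite subUset sub1set.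
  rewrite (subsetP (subset_reach _ _ _) _ xA) /=.
  apply/subsetP => y /reachP[a aA' ay].
  have {}ay : connect (avoiding_adj D (F1 :|: F2)) a y.
    apply: connect_sub ay => u v /and3P[]; rewrite !inE !negb_or.
    move=> /andP[_ uD] /andP[_ vD] uv; apply: connect1.
    by rewrite /avoiding_adj uD vD (spanning_adjW (subsetUr _ _) uv).
  move: aA'; rewrite !inE => /orP[/andP[_ aA]|].
    by apply/exists_inP; exists a.
  rewrite negb_or => /andP[/andP[xa /andP[aD _]] xaF].
  apply/exists_inP; exists x => //; apply: connect_trans ay; apply: connect1.
  by rewrite /avoiding_adj xD aD /spanning_adj xa inE xaF.
apply: (@le_trans _ _ (expectation p E1
    (fun F1 => (1 - s) ^+ #|A|.-1 * (1 - s) ^+ #|F1 :&: B|))).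
  exact: ler_expectation.
rewrite expectationZ expectation_expr_cards cardB.
have -> : 1 - p + p * (1 - s) = 1 - p * s by ring.
have ps01 : 0 <= 1 - p * s <= 1 by nra.
rewrite [in leRHS](cardsD1 x A) xA -(_ : #|A|.-1 = #|A :\ x|); last first.
  by rewrite (cardsD1 x A) xA.
rewrite exprSr; apply: ler_wpM2l; first by apply: exprn_ge0; lra.
(* Fewer than [K] vertices are explored or active, so [x] has at least [k - K] new neighbours. *)
apply: le_trans zk; apply: ler_wiXn2l; [lra..|].
have : (#|[set y | adj x y]| <= #|N| + #|D :|: A|)%N.
  apply: leq_trans (leq_card_setU _ _); apply: subset_leq_card.
  by apply/subsetP => y; rewrite !inE => -> /=; rewrite orNb.
have : (#|D :|: A| <= #|D| + #|A|)%N by apply: leq_card_setU.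
by have := degk x; rewrite /degree; clear -ltK; lia.
Qed.

Section TwoRounds.
Variables (k K : nat) (p1 s : R).
Hypotheses (p1_01 : 0 <= p1 <= 1) (s01 : 0 <= s <= 1).
Hypothesis survive : (1 - p1 * s) ^+ (k - K) <= 1 - s.
Hypothesis degree_ge : forall x : G, (k <= degree x)%N.

Lemma prob_large x :
  s <= expectation p1 (edges G) (fun F => (x \in large K F)%:R).
Proof.
have xD : [disjoint [set x] & set0 : {set G}] by rewrite -setI_eq0 setI0.
have EG (u v : G) : adj u v -> u \notin (set0 : {set G}) ->
    v \notin (set0 : {set G}) -> [set u; v] \in edges G.
  by move=> uv _ _; apply/imsetP; exists (u, v); rewrite ?inE.
have := exploration_fail p1_01 s01 survive degree_ge xD EG.
rewrite cards1 expr1 => fail.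
suff : 1 <= expectation p1 (edges G) (fun F => (x \in large K F)%:R) +
  expectation p1 (edges G)
    (fun F => (#|set0 : {set G}| + #|reach F [set x] set0| < K)%N%:R) by lra.
rewrite -[leLHS](expectation_cst p1 (edges G)) -expectationD.
apply: ler_expectation => // F _; rewrite inE cards0 add0n.
case: (leqP K #|component F x|) => [_|ltK]; first by rewrite lerDl ler0n.
rewrite add0r (leq_ltn_trans _ ltK)//; apply: subset_leq_card.
apply/subsetP => y /reachP[_ /set1P-> xy]; rewrite inE.
by apply: connect_sub xy => u v /and3P[_ _ uv]; apply: connect1.
Qed.

Lemma largeW F F' : F \subset F' -> large K F \subset large K F'.
Proof.
move=> sF; apply/subsetP => x; rewrite !inE => /leq_trans; apply.
apply: subset_leq_card; apply/subsetP => y; rewrite !inE.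
exact: connect_spanningW.
Qed.

Lemma prob_edge_large e : e \in edges G ->
  s ^+ 2 <= expectation p1 (edges G) (fun F => (e \subset large K F)%:R).
Proof.
move=> /imsetP[[u v] _ ->] /=.
have mono x F F' : F \subset F' ->
    (x \in large K F)%:R <= (x \in large K F')%:R :> R.
  move=> /largeW/subsetP sF; rewrite ler_nat.
  by case: (boolP (x \in large K F)) => // /sF->.
apply: le_trans (_ : expectation p1 (edges G) (fun F => (u \in large K F)%:R) *
   expectation p1 (edges G) (fun F => (v \in large K F)%:R) <= _).
  have [s0 _] := andP s01.
  by rewrite expr2; apply: ler_pM => //; apply: prob_large.
rewrite [leRHS](@eq_expectation _ _ _ _ _ (fun F =>
    (u \in large K F)%:R * (v \in large K F)%:R)).
  exact: (harris (edges G) p1_01 (mono u) (mono v)).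
by move=> F _; rewrite subUset !sub1set -natrM mulnb.
Qed.

Lemma expectation_excess p2 : 0 <= p2 <= 1 -> (0 < K)%N ->
  p2 * ((s ^+ 2 - p1) * #|edges G|%:R) - #|G|%:R / K%:R
    <= expectation (1 - (1 - p1) * (1 - p2)) (edges G) (@excess R G).
Proof.
move=> p2_01 K0; rewrite expectation_sprinkle.
set E := edges G; pose Q F := [set e : {set G} | e \subset large K F].
(* Second round, given [F]: an edge inside the large components counts unless it is already in [F],
   which excludes at most [#|F|] edges. *)
apply: (@le_trans _ _ (expectation p1 E
    (fun F => p2 * (#|E :&: Q F|%:R - #|F|%:R) - #|G|%:R / K%:R))); last first.
  apply: ler_expectation => // F FE.
  apply: (@le_trans _ _ (expectation p2 E
      (fun H => #|H :&: (Q F :\: F)|%:R - #|G|%:R / K%:R))); last first.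
    apply: ler_expectation => // H _; rewrite setIDA.
    exact: excess_sprinkle.
  rewrite expectationB expectation_cst expectation_cards lerD2r.
  apply: ler_wpM2l; first lra.
  rewrite lerBlDr -natrD ler_nat -(cardsID F (E :&: Q F)) addnC setIDA leq_add2l.
  exact/subset_leq_card/subsetIr.
rewrite expectationB expectation_cst lerD2r expectationZ expectationB.
apply: ler_wpM2l; first lra.
rewrite mulrBl; apply: lerB; last first.
  rewrite (@eq_expectation _ _ _ _ _ (fun F => #|F :&: E|%:R)).
    by rewrite expectation_cards setIid.
  by move=> F /setIidPl->.
rewrite (@eq_expectation _ _ _ _ _
    (fun F => \sum_(e in E) (e \subset large K F)%:R)).
  rewrite expectation_sum mulr_natr -sumr_const; apply: ler_sum => e.
  exact: prob_edge_large.
move=> F _; rewrite -natr_sum -sum1_card; congr _%:R.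
rewrite big_mkcond /= [RHS]big_mkcond; apply: eq_bigr => e _.
by rewrite !inE; case: (e \in E); case: (_ \subset _).
Qed.

End TwoRounds.
End Exploration.

(** * Depth-first search forests *)

Section Ancestry.
Variable T : finType.
Implicit Types (anc : T -> seq T) (x y z : T) (s t : seq T).

(* A rooted forest is given by the list of proper ancestors of each vertex, the
   parent first.  The root of each tree has the least index in it, which makes
   the rooting a function of the edges. *)
Record rooted_forest anc : Prop := RootedForest {
  anc_parent : forall z y s, anc z = y :: s -> s = anc y;
  anc_uniq : forall z, uniq (z :: anc z);
  anc_root : forall z, (enum_rank (last z (anc z)) <= enum_rank z)%N
}.

Definition tree_edges anc : {set {set T}} :=
  [set [set z; head z (anc z)] | z in [set z | anc z != [::]]].

Variable anc : T -> seq T.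
Hypothesis forest : rooted_forest anc.

Lemma anc_cat z t y s : anc z = t ++ y :: s -> s = anc y.
Proof.
elim: t z => [|x t IH] z /= ez; first exact: anc_parent ez.
by apply: (IH x); rewrite -(anc_parent forest ez).
Qed.

Lemma anc_split z y : y \in anc z -> exists t, anc z = t ++ y :: anc y.
Proof.
move=> yz; case/splitPr: {-1}_ / yz (erefl (anc z)) => t s ez.
by exists t; rewrite (anc_cat ez).
Qed.

Lemma anc_irr z : z \notin anc z.
Proof. by have /= /andP[] := anc_uniq forest z. Qed.

Lemma anc_trans z y x : y \in anc z -> x \in anc y -> x \in anc z.
Proof.
by move=> /anc_split[t ->] xy; rewrite mem_cat inE xy !orbT.
Qed.

Lemma anc_between z t y s x : anc z = t ++ y :: s -> x \in t -> y \in anc x.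
Proof.
move=> ez xt; case/splitPr: xt ez => t1 t2 ez.
have : anc z = t1 ++ x :: (t2 ++ y :: s) by rewrite ez -catA.
by move/anc_cat <-; rewrite mem_cat inE eqxx orbT.
Qed.

Lemma anc_comparable z x y : x \in anc z -> y \in anc z ->
  [\/ x = y, x \in anc y | y \in anc x].
Proof.
move=> xz /anc_split[t ez]; move: xz; rewrite ez mem_cat inE.
case/or3P => [xt|/eqP->|xy]; [|by constructor 1|by constructor 2].
by constructor 3; apply: anc_between ez xt.
Qed.

End Ancestry.

Lemma last_anc (T : finType) (anc : T -> seq T) z y s :
    rooted_forest anc -> anc z = y :: s ->
  last z (anc z) = last y (anc y).
Proof. by move=> fa ez; rewrite ez /= (anc_parent fa ez). Qed.

Lemma tree_edges_root (T : finType) (anc : T -> seq T) x y :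
    rooted_forest anc -> [set x; y] \in tree_edges anc ->
  last x (anc x) = last y (anc y).
Proof.
move=> fa /imsetP[z]; rewrite inE; case ez: (anc z) => [//|w s] _ /=.
have rzw := last_anc fa ez => exy.
have /set2P xzw : x \in [set z; w] by rewrite -exy set21.
have /set2P yzw : y \in [set z; w] by rewrite -exy set22.
by case: xzw yzw => -> [] ->.
Qed.

Lemma parent_tree_edge (T : finType) (anc : T -> seq T) z y s :
  anc z = y :: s -> [set z; y] \in tree_edges anc.
Proof. by move=> ez; apply/imsetP; exists z; rewrite ?inE ez. Qed.

Lemma tree_edges_root_nil (T : finType) (anc anc' : T -> seq T) z :
    rooted_forest anc -> rooted_forest anc' ->
    tree_edges anc = tree_edges anc' ->
  anc z = [::] -> anc' z = [::].
Proof.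
move=> fa fa' eT ez.
(* Climbing along [anc'] never changes the root for [anc], as each step is a common tree edge. So
   both forests have the same trees, whose roots are their least vertices. *)
have same_root s x : anc' x = s -> last (last x (anc' x)) (anc (last x (anc' x)))
    = last x (anc x).
  elim: s x => [|y s IH] x ex; first by rewrite ex.
  rewrite (last_anc fa' ex) IH -?(anc_parent fa' ex)//.
  apply: tree_edges_root => //; rewrite eT setUC; exact: parent_tree_edge ex.
have := same_root _ z erefl; set r := last z _; rewrite ez /= => er.
have rz : r = z.
  apply/enum_rank_inj/val_inj/eqP; rewrite /= eqn_leq anc_root//=.
  by rewrite -{1}er anc_root.
case ez': (anc' z) => [//|y s]; have := anc_irr fa' z.
by rewrite -{1}rz /r ez' /= mem_last.
Qed.

(** Induction on the depth of [z]. Its parent [y] in one forest is its parent or its child in the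
    other; as a child, [y] would have [z] among its ancestors, which by induction are the same in
    both. *)
Lemma tree_edges_inj (T : finType) (anc anc' : T -> seq T) :
    rooted_forest anc -> rooted_forest anc' ->
    tree_edges anc = tree_edges anc' ->
  anc =1 anc'.
Proof.
move=> fa fa' eT z; move: {-1}(anc z) (erefl (anc z)) => s.
elim: s z => [|y s IH] z ez.
  by rewrite (tree_edges_root_nil fa fa' eT ez).
have ey := anc_parent fa ez; have ey' := IH y (esym ey).
have : [set z; y] \in tree_edges anc' by rewrite -eT; apply: parent_tree_edge ez.
case/imsetP => w; rewrite inE; case ew: (anc' w) => [//|x t] _ /= ezy.
have /set2P zwx : z \in [set w; x] by rewrite -ezy set21.
have /set2P ywx : y \in [set w; x] by rewrite -ezy set22.
have zNy : z != y.
  by have := anc_irr fa z; rewrite ez inE negb_or => /andP[].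
have xt := anc_parent fa' ew.
case: zwx ywx => [zw|zx] [yw|yx].
- by rewrite zw yw eqxx in zNy.
- by rewrite zw ew xt -yx -ey'.
- have := anc_irr fa z; rewrite ez inE => /norP[_].
  by rewrite ey' yw ew zx mem_head.
by rewrite zx yx eqxx in zNy.
Qed.

Section DepthFirstSearch.
Variable G : sgraph.
Implicit Types (F : {set {set G}}) (anc : G -> seq G) (W : {set G}).

Record normal_forest F anc : Prop := NormalForest {
  normal_rooted :> rooted_forest anc;
  normal_parent : forall z y s, anc z = y :: s -> @spanning_adj G F z y;
  normal_comparable : forall u v, @spanning_adj G F u v ->
    u \in anc v \/ v \in anc u
}.

(* [W] is the set of visited vertices and [st] the stack. *)
Record dfs_state F anc W (st : seq G) : Prop := DfsState {
  dfs_rooted : rooted_forest anc;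
  dfs_parent : forall z y s, anc z = y :: s -> @spanning_adj G F z y;
  dfs_visited : forall z y, y \in anc z -> (y \in W) && (z \in W);
  dfs_comparable : forall u v, u \in W -> v \in W -> @spanning_adj G F u v ->
    u \in anc v \/ v \in anc u;
  dfs_stack : st = [::] \/ exists2 y, y \in W & st = y :: anc y;
  dfs_finished : forall u v, u \in W -> u \notin st -> v \notin W ->
    ~~ @spanning_adj G F u v;
  dfs_root : forall y v, st = y :: anc y -> v \notin W ->
    (enum_rank (last y (anc y)) <= enum_rank v)%N
}.

Lemma dfs_push F anc W st y v :
    dfs_state F anc W st -> st = y :: anc y -> y \in W -> v \notin W ->
    @spanning_adj G F y v ->
  dfs_state F (fun z => if z == v then st else anc z) (v |: W) (v :: st).
Proof.
move=> S est yW vW yv; have [fa par vis comp stk fin root] := S.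
have notW z : z \in W -> (z == v) = false.
  by move=> zW; apply: contraNF vW => /eqP <-.
have stW z : z \in st -> z \in W.
  by rewrite est inE => /predU1P[->//|/vis/andP[]].
split.
- split=> [z x s|z|z].
  + case: eqP => [_|_ ez].
      by rewrite est => -[<- <-]; rewrite notW.
    rewrite notW; first exact: (anc_parent fa ez).
    by have /vis/andP[] : x \in anc z by rewrite ez mem_head.
  + case: eqP => [->|_]; last exact: anc_uniq.
    rewrite cons_uniq {2}est (anc_uniq fa) andbT.
    by apply: contra vW; apply: stW.
  + case: eqP => [->|_]; last exact: anc_root.
    by rewrite est /=; apply: root.
- move=> z x s; case: eqP => [->|_]; last exact: par.
  by rewrite est => -[<- _]; rewrite spanning_adj_sym.
- move=> z x; case: eqP => [-> /stW xW|_ /vis/andP[xW zW]].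
    by rewrite !inE xW eqxx orbT.
  by rewrite !inE xW zW !orbT.
(* Finished vertices have no unvisited neighbour, so the visited neighbours of [v] are on the stack,
   that is, among its new ancestors. *)
- have toN u : u \in W -> @spanning_adj G F u v -> u \in st.
    by move=> uW; apply: contraTT => uNst; apply: fin.
  move=> u w; rewrite !inE => /predU1P[->|uW] /predU1P[->|wW].
  + by rewrite spanning_adj_irrefl.
  + by rewrite eqxx spanning_adj_sym => vw; right; apply: toN.
  + by rewrite eqxx => uv; left; apply: toN.
  + by rewrite !notW//; apply: comp.
- by right; exists v; rewrite ?setU11 ?eqxx.
- move=> u w; rewrite !inE !negb_or => /predU1P[->|uW] /andP[].
    by rewrite eqxx.
  by move=> _ ust /andP[_ wW]; apply: fin.
- move=> y0 w [<- _]; rewrite !inE negb_or eqxx => /andP[_ wW].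
  by rewrite est /=; apply: root.
Qed.

Lemma dfs_pop F anc W y :
    dfs_state F anc W (y :: anc y) ->
    (forall v, v \notin W -> ~~ @spanning_adj G F y v) ->
  dfs_state F anc W (anc y).
Proof.
move=> S done; have [fa par vis comp stk fin root] := S; split=> //.
- case ey: (anc y) => [|x s]; first by left.
  right; exists x; last by rewrite (anc_parent fa ey).
  by have /vis/andP[] : x \in anc y by rewrite ey mem_head.
- move=> u v uW uNst vW; have [->|uy] := eqVneq u y; first exact: done.
  by apply: fin; rewrite // inE negb_or uy.
- move=> x v ey vW; rewrite -(last_anc fa ey); exact: root.
Qed.

(** Starting at the least unvisited vertex makes each root the least vertex of its tree. *)
Lemma dfs_new_root F anc W v :
    dfs_state F anc W [::] -> v \notin W ->
    (forall w, w \notin W -> (enum_rank v <= enum_rank w)%N) ->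
  dfs_state F anc (v |: W) [:: v].
Proof.
move=> S vW vmin; have [fa par vis comp stk fin root] := S.
have ev : anc v = [::].
  case ev: (anc v) => [//|y s]; have := vis v y; rewrite ev mem_head => /(_ isT).
  by rewrite (negPf vW) andbF.
split=> //.
- by move=> z y /vis/andP[yW zW]; rewrite !inE yW zW !orbT.
- move=> u w; rewrite !inE => /predU1P[->|uW] /predU1P[->|wW].
  + by rewrite spanning_adj_irrefl.
  + by rewrite spanning_adj_sym (negPf (fin _ _ wW _ vW)).
  + by rewrite (negPf (fin _ _ uW _ vW)).
  + exact: comp.
- by right; exists v; rewrite ?setU11 ?ev.
- move=> u w; rewrite !inE !negb_or => /predU1P[->|uW]; rewrite ?eqxx// => _.
  by move=> /andP[_ wW]; apply: fin.
- by move=> y0 w [<- _]; rewrite !inE negb_or ev /= => /andP[_ wW]; apply: vmin.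
Qed.

Lemma normal_forest_exists F : exists anc, normal_forest F anc.
Proof.
suff [anc S] : exists anc, dfs_state F anc setT [::].
  have [fa par _ comp _ _ _] := S; exists anc; split=> // u v.
  by apply: comp; rewrite inE.
(* Visiting a vertex lengthens the stack by one, whence the weight 2 of unvisited vertices; a pop
   shortens it. *)
suff dfs n anc W st : (size st + (#|~: W|).*2 < n)%N ->
    dfs_state F anc W st -> exists anc, dfs_state F anc setT [::].
  apply: (dfs _ (fun=> [::]) set0 [::] (ltnSn _)).
  split=> //; [by move=> u v; rewrite inE | by left |].
  by move=> u v; rewrite inE.
elim: n anc W st => // n IH anc W st.
move=> ltn S; have [fa par vis comp stk fin root] := S.
have cardC v : v \notin W -> #|~: W| = #|~: (v |: W)|.+1.
  by move=> vW; rewrite (cardsD1 v) inE vW setUC setCU setDE.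
case: stk => [est|[y yW est]]; rewrite est in S ltn.
  have [WT|[v0 v0W]] := set_0Vmem (~: W).
    by exists anc; rewrite -[setT]setC0 -WT setCK.
  rewrite inE in v0W.
  case: (@arg_minnP _ v0 [pred v | v \notin W] (fun v : G => enum_rank v) v0W) => v /= vW vmin.
  apply: (IH _ _ _ _ (dfs_new_root S vW vmin)).
  rewrite (cardC v vW) in ltn.
  by move: ltn; clear; rewrite /=; lia.
have [/existsP[v /andP[vW yv]]|noV] :=
    boolP [exists v, (v \notin W) && @spanning_adj G F y v].
  apply: (IH _ _ _ _ (dfs_push S erefl yW vW yv)).
  rewrite (cardC v vW) in ltn.
  by move: ltn; clear; rewrite /=; lia.
apply: (IH _ _ _ _ (dfs_pop S _)); first exact: ltn.
by move=> v vW; apply: contra noV => yv; apply/existsP; exists v; rewrite vW.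
Qed.

End DepthFirstSearch.

(** * Short edges of a forest *)

Section ShortEdges.
Variable G : sgraph.
Implicit Types (F : {set {set G}}) (anc : G -> seq G) (l : nat).

(** This depends on the forest alone and not on [F], so it can be fixed before summing over the back
    edges. *)
Definition short_edges anc l : {set {set G}} :=
  [set [set u.1; u.2] | u : G * G & adj u.1 u.2 && (u.2 \in take l (anc u.1))].

Lemma path_anc F anc z : normal_forest F anc ->
  path (@spanning_adj G F) z (anc z).
Proof.
move=> nf; move: {-1}(anc z) (erefl (anc z)) => s.
elim: s z => //= y s IH z ez; rewrite (normal_parent nf ez) /=.
exact/IH/esym/(anc_parent nf ez).
Qed.

(** Each vertex other than a root gives one tree edge at most, and the least vertex of a component
    of [F] is a root. *)
Lemma card_tree_edges F anc : normal_forest F anc ->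
  (#|tree_edges anc| + ncomponents F <= #|G|)%N.
Proof.
move=> nf; rewrite -cardsT -(cardsID [set z | anc z != [::]]) !setTI.
apply: leq_add; first exact: leq_imset_card.
apply: subset_leq_card; apply/subsetP => x; rewrite !inE negbK => /minimalP xmin.
have xr : connect (@spanning_adj G F) x (last x (anc x)).
  by apply/connectP; exists (anc x) => //; apply: path_anc.
have rx : last x (anc x) = x.
  apply/enum_rank_inj/val_inj/eqP; rewrite /= eqn_leq xmin// andbT.
  exact: (anc_root nf).
case ex: (anc x) => [//|y s]; have := anc_irr nf x.
by rewrite -{1}rx ex /= mem_last.
Qed.

Lemma tree_edges_sub F anc : normal_forest F anc -> tree_edges anc \subset F.
Proof.
move=> nf; apply/subsetP => e /imsetP[z]; rewrite inE.
by case ez: (anc z) => [//|y s] _ ->; have /andP[] := normal_parent nf ez.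
Qed.

Lemma excess_le_back_edges (R : realType) F anc : normal_forest F anc ->
  excess R F <= #|F :\: tree_edges anc|%:R.
Proof.
move=> nf; rewrite cardsD (setIidPr (tree_edges_sub nf)).
rewrite natrB ?subset_leq_card ?tree_edges_sub//.
have : (#|tree_edges anc|%:R + (ncomponents F)%:R <= #|G|%:R :> R).
  by rewrite -natrD ler_nat card_tree_edges.
rewrite /excess; lra.
Qed.

(** An edge outside the forest closes a cycle with the tree path between its comparable ends, so
    that path is short. *)
Lemma back_edges_short F anc l : F \subset edges G -> normal_forest F anc ->
    ~ has_cycle_ge l (spanning_subgraph F) ->
  F :\: tree_edges anc \subset short_edges anc l.
Proof.
move=> FE nf noC; apply/subsetP => e; rewrite inE => /andP[eT eF].
have short u v : u \in anc v -> [set u; v] = e -> @spanning_adj G F u v ->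
    e \in short_edges anc l.
  move=> uv ee auv; have [t ev] := anc_split nf uv.
  apply/imsetP; exists (v, u); rewrite /= 1?setUC//.
  rewrite inE adj_sym; have /andP[-> _] /= := auv.
  case: t ev => [|w t] ev.
    by case/negP: eT; rewrite -ee setUC; apply: parent_tree_edge ev.
  have lt_tl : (size t + 3 < l)%N.
    rewrite ltnNge; apply/negP => le_lt; apply: noC.
    exists (v :: rcons (w :: t) u); last by rewrite /= size_rcons; lia.
    split; last by rewrite /= size_rcons.
    have ev' : anc v = rcons (w :: t) u ++ anc u by rewrite ev cat_rcons.
    apply/andP; split.
      have cyc : path (@spanning_adj G F) v (rcons (rcons (w :: t) u) v).
        rewrite rcons_path last_rcons auv andbT.
        by have := path_anc v nf; rewrite ev' cat_path => /andP[].
      exact: cyc.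
    by have := anc_uniq nf v; rewrite ev' -cat_cons cat_uniq => /andP[].
  rewrite ev -cat_rcons take_cat size_rcons ifF; last first.
    by rewrite /=; move: lt_tl; clear; lia.
  by rewrite mem_cat mem_rcons mem_head.
have /imsetP[[u v] /=] := subsetP FE e eF; rewrite inE /= => uv ee.
have auv : @spanning_adj G F u v by rewrite /spanning_adj uv -ee.
have [uav|vau] := normal_comparable nf auv; first exact: short uav _ auv.
by apply: short vau _ _; rewrite 1?setUC// spanning_adj_sym.
Qed.

Definition degree_in (S : {set G}) x : nat := #|[set y in S | adj x y]|.

Definition degree_sum (S : {set G}) : nat := \sum_(x in S) degree_in S x.

Section Sparse.
Variables (R : realType) (B : R) (l : nat) (anc : G -> seq G).
Hypothesis forest : rooted_forest anc.
Hypothesis l_gt0 : (0 < l)%N.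
Hypothesis sparse : forall S : {set G}, (#|S| <= 3 * l)%N ->
  (degree_sum S)%:R <= B * #|S|%:R.

Let up z := [set y in take l (anc z) | adj z y].

Lemma sum_up_le (Q S : {set G}) : Q \subset S ->
    (forall z y, z \in Q -> y \in take l (anc z) -> y \in S) ->
  (\sum_(z in Q) #|up z| <= degree_sum S)%N.
Proof.
move=> QS upS; rewrite /degree_sum [leqRHS](big_setID Q) /= (setIidPr QS).
apply: leq_trans (leq_addr _ _); apply: leq_sum => z zQ.
apply: subset_leq_card; apply/subsetP => y; rewrite !inE => /andP[yz ->].
by rewrite (upS z).
Qed.

(* [Q] is a union of subtrees, within [W], hanging from a common vertex whose
   own ancestors are listed by [s] (a whole union of trees when [s] is empty). *)
Definition hanging (W Q : {set G}) (s : seq G) : Prop :=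
  [/\ Q \subset W,
      forall z y, z \in W -> y \in anc z -> y \in Q -> z \in Q &
      forall z, z \in Q -> exists2 t, anc z = t ++ s & {subset t <= Q}].

(* A smallest hanging set with at least [l] vertices works: if it had more than
   [2 * l], then one of its subtrees without its root, or the complement of that
   subtree, would be a smaller one. *)
Lemma hanging_piece (W : {set G}) :
    (forall z y, z \in W -> y \in anc z -> y \in W) -> (l <= #|W|)%N ->
  exists Q s, hanging W Q s /\ (l <= #|Q| <= 2 * l)%N.
Proof.
move=> Wanc lW.
have : exists n, `[< exists Q s, [/\ hanging W Q s, (l <= #|Q|)%N & #|Q| = n] >].
  exists #|W|; apply/asboolP; exists W, [::]; split=> //; split=> // z zW.
  by exists (anc z); rewrite ?cats0// => y; apply: Wanc.
case/ex_minnP => n /asboolP[Q [s [[QW Qdown Qup] lQ <-{n}]]] Qmin.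
have {Qmin} notsmaller (Q' : {set G}) s' : Q' \subset Q -> hanging W Q' s' ->
    (l <= #|Q'|)%N -> Q \subset Q'.
  move=> sQ hQ' lQ'; suff /eqP-> : Q' == Q by [].
  rewrite eqEcard sQ Qmin//; apply/asboolP.
  by exists Q', s'.
exists Q, s; split=> //; rewrite lQ leqNgt; apply/negP => gtQ.
have [y0 y0Q] : exists y, y \in Q.
  by apply/set0Pn; rewrite -card_gt0; apply: leq_trans lQ.
(* A vertex of least depth is the root of one of the subtrees that make up [Q]. *)
have [y /= yQ ymin] := @arg_minnP _ y0 [pred z | z \in Q] (fun z => size (anc z)) y0Q.
have ys : anc y = s.
  have [t ey tQ] := Qup y yQ; case: t ey tQ => [//|u t] ey tQ.
  have /ymin : u \in Q by apply: tQ; rewrite mem_head.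
  by rewrite -(anc_parent forest ey) ey /= ltnn.
pose Q1 := [set z in Q | (z == y) || (y \in anc z)].
have yQ1 : y \in Q1 by rewrite inE yQ eqxx.
have Q1Q : Q1 \subset Q by apply/subsetP => z; rewrite inE => /andP[].
have sNQ w : w \in Q -> w \notin s.
  move=> wQ; have [t ew _] := Qup w wQ; apply: contra (anc_irr forest w) => ws.
  by rewrite ew mem_cat ws orbT.
(* Strictly more than [l], so that [l] vertices remain without the root [y]; otherwise [Q :\: Q1]
   has more than [l]. *)
have [lQ1|ltQ1] := ltnP l #|Q1|.
  have hQ1 : hanging W (Q1 :\ y) (y :: s).
    split=> [|z w zW wz|z].
    - exact: subset_trans (subD1set _ _) (subset_trans Q1Q QW).
    - rewrite !inE => /and3P[wy wQ]; rewrite (negPf wy) /= => yw.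
      have yz := anc_trans forest wz yw.
      rewrite (Qdown z w)// yz orbT !andbT.
      by apply: contraTneq yz => ->; apply: anc_irr.
    - rewrite !inE => /and3P[zy zQ]; rewrite (negPf zy) /= => yz.
      have [t ez] := anc_split forest yz; exists t; first by rewrite ez ys.
      move=> w wt; have yw := anc_between forest ez wt.
      have wW : w \in W.
        by apply: (Wanc z); rewrite ?(subsetP QW)// ez mem_cat wt.
      rewrite !inE yw orbT (Qdown w y)//= !andbT.
      by apply: contraTneq yw => ->; apply: anc_irr.
  have /subsetP/(_ _ yQ) : Q \subset Q1 :\ y.
    apply: notsmaller hQ1 _; first exact: subset_trans (subD1set _ _) Q1Q.
    by rewrite (cardsD1 y) yQ1 in lQ1.
  by rewrite !inE eqxx.
have hQ2 : hanging W (Q :\: Q1) s.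
  split=> [|z w zW wz|z].
  - exact: subset_trans (subsetDl _ _) QW.
  - rewrite inE => /andP[wQ1 wQ]; have zQ := Qdown z w zW wz wQ.
    rewrite inE zQ andbT; apply: contra wQ1; rewrite !inE wQ zQ /=.
    case/predU1P => [zy|yz]; first by have := sNQ w wQ; rewrite -ys -zy wz.
    have [->|wy|yw] := anc_comparable forest wz yz; rewrite ?eqxx//.
      by have := sNQ w wQ; rewrite -ys wy.
    by rewrite yw orbT.
  - rewrite inE => /andP[zQ1 zQ]; have [t ez tQ] := Qup z zQ; exists t => // w wt.
    rewrite inE tQ// andbT; apply: contra zQ1; rewrite !inE zQ tQ//=.
    have wz : w \in anc z by rewrite ez mem_cat wt.
    case/predU1P => [<-|yw]; first by rewrite wz orbT.
    by rewrite (anc_trans forest wz yw) orbT.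
have /subsetP/(_ _ yQ) : Q \subset Q :\: Q1.
  apply: notsmaller hQ2 _; first exact: subsetDl.
  by rewrite cardsD (setIidPr Q1Q); lia.
by rewrite inE yQ1.
Qed.

(** Pieces [Q] are cut off one after the other; [W :\: Q] stays closed under ancestors because [Q]
    is closed under descendants in [W]. *)
Lemma sum_up_sparse (W : {set G}) :
    (forall z y, z \in W -> y \in anc z -> y \in W) ->
  (\sum_(z in W) #|up z|)%:R <= 3 * B * #|W|%:R.
Proof.
have B0 (S : {set G}) : (#|S| <= 3 * l)%N -> 0 <= B * #|S|%:R.
  by move=> /sparse; apply: le_trans; rewrite ler0n.
have [n] := ubnP #|W|; elim: n W => // n IH W ltn Wanc.
have [ltWl|leWl] := ltnP #|W| l.
  have W3l : (#|W| <= 3 * l)%N by lia.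
  apply: (@le_trans _ _ (degree_sum W)%:R).
    rewrite ler_nat; apply: sum_up_le => // z y zW /mem_take.
    exact: Wanc.
  have := B0 W W3l; have := sparse W3l; lra.
have [Q [s [[QW Qdown Qup] /andP[lQ Q2l]]]] := hanging_piece Wanc leWl.
rewrite (big_setID Q) /= (setIidPr QW) natrD.
have -> : #|W|%:R = #|Q|%:R + #|W :\: Q|%:R :> R.
  by rewrite -natrD -(cardsID Q W) (setIidPr QW).
rewrite mulrDr; apply: lerD; last first.
  apply: IH.
    have := cardsID Q W; rewrite (setIidPr QW).
    by move: ltn lQ l_gt0; clear; lia.
  move=> z y; rewrite !inE => /andP[zQ zW] yz; rewrite (Wanc z)// andbT.
  by apply: contra zQ; apply: Qdown.
(* The [l] closest ancestors of a vertex of [Q] lie in [Q] or among the first [l] of [s]; as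
   [l <= #|Q|], the bound [3 * l] is at most [3 * #|Q|]. *)
pose S := Q :|: [set y in take l s].
have cardS : (#|S| <= 3 * l)%N.
  have : (#|[set y in take l s]| <= l)%N.
    rewrite cardsE; apply: leq_trans (card_size _) _; rewrite size_take_min.
    exact: geq_minl.
  have : (#|S| <= #|Q| + #|[set y in take l s]|)%N by apply: leq_card_setU.
  by move: Q2l; clear; lia.
apply: (@le_trans _ _ (degree_sum S)%:R).
  rewrite ler_nat; apply: sum_up_le; first exact: subsetUl.
  move=> z y /Qup[t -> tQ]; rewrite take_cat; case: ltnP => _ yt.
    by rewrite inE tQ// (mem_take yt).
  move: yt; rewrite mem_cat => /orP[/tQ yQ|yt]; first by rewrite inE yQ.
  rewrite !inE; apply/orP; right.
  have : take (l - size t) s = take (l - size t) (take l s).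
    by rewrite take_takel// leq_subr.
  by move=> es; rewrite es in yt; apply: mem_take yt.
apply: le_trans (sparse cardS) _.
have B0' : 0 <= B.
  have [z zQ] : exists z, z \in Q.
    by apply/set0Pn; rewrite -card_gt0; apply: leq_trans lQ.
  have : (#|[set z]| <= 3 * l)%N by rewrite cards1; lia.
  by move/B0; rewrite cards1 mulr1.
rewrite -mulrA mulrCA ler_wpM2l// -natrM ler_nat; apply: leq_trans cardS _.
by rewrite leq_mul2l lQ.
Qed.

Lemma card_short_edges : #|short_edges anc l|%:R <= 3 * B * #|G|%:R.
Proof.
apply: (@le_trans _ _ (\sum_(z in [set: G]) #|up z|)%:R); last first.
  by rewrite -cardsT; apply: sum_up_sparse => z y; rewrite !inE.
rewrite ler_nat; apply: leq_trans (leq_imset_card _ _) _.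
have -> : (\sum_(z in [set: G]) #|up z| =
    \sum_(z in [set: G]) \sum_(y in up z) 1)%N.
  by apply: eq_bigr => z _; rewrite sum1_card.
rewrite pair_big_dep /= sum1_card; apply: subset_leq_card.
apply/subsetP => -[z y]; rewrite inE /= => /andP[zy yz].
by rewrite unfold_in /= !inE yz zy.
Qed.

End Sparse.
End ShortEdges.

(** * Large excess without a long cycle is unlikely *)

Section NoLongCycle.
Variable R : realType.

Lemma subset_weightE (T : finType) (p : R) (E F : {set T}) : F \subset E ->
  subset_weight p E F = p ^+ #|F| * (1 - p) ^+ (#|E| - #|F|).
Proof.
move=> FE; rewrite /subset_weight (big_setID F) /= (setIidPr FE).
rewrite (eq_bigr (fun=> p)); last by move=> e ->.
rewrite [X in _ * X](eq_bigr (fun=> 1 - p)); last first.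
  by move=> e; rewrite inE => /andP[/negPf->].
by rewrite !prodr_const cardsD (setIidPr FE).
Qed.

(** The binomial theorem, read off from the total mass 1 of a random subset of density
    [a / (1 + a)]. *)
Lemma sum_powerset_expr (T : finType) (a : R) (S : {set T}) : 0 <= a ->
  \sum_(X in powerset S) a ^+ #|X| = (1 + a) ^+ #|S|.
Proof.
move=> a0; have a1 : 1 + a != 0 by lra.
have := expectation_cst (a / (1 + a)) S 1; rewrite /expectation => total.
rewrite -[RHS]mulr1 -[X in _ = _ * X]total.
rewrite big_distrr /=; apply: eq_bigr => X; rewrite inE => XS.
rewrite mulr1 subset_weightE// -{1}(subnKC (subset_leq_card XS)) exprD.
rewrite mulrACA -!exprMn.
have -> : (1 + a) * (a / (1 + a)) = a by field.
have -> : (1 + a) * (1 - a / (1 + a)) = 1 by field.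
by rewrite expr1n mulr1.
Qed.

Variables (G : sgraph) (p x sigma : R) (l : nat).
Hypothesis p_half : 0 <= p <= 1 / 2.
Hypothesis short : forall anc : G -> seq G, rooted_forest anc ->
  #|short_edges anc l|%:R <= sigma.

(* A graph [F] without long cycle is its normal forest together with at least
   [excess F] short edges, and the forest determines where these may lie.
   Summing first over the short edges, then over the forests, whose weights add
   up to at most 1, gives the bound; [expR (|back edges| - x) >= 1] is inserted
   to count the former. *)
Lemma prob_no_long_cycle :
  expectation p (edges G) (fun F =>
    (`[< ~ has_cycle_ge l (spanning_subgraph F) >] && (x <= excess R F))%:R)
  <= expR (2 * p * expR 1 * sigma - x).
Proof.
have p_half' := p_half; have p01 : 0 <= p <= 1 by lra.
have [anc nf] := choice (@normal_forest_exists G).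
pose T F := tree_edges (anc F); set E := edges G.
pose bad (F : {set {set G}}) :=
  `[< ~ has_cycle_ge l (spanning_subgraph F) >] && (x <= excess R F).
(* The odds of keeping an edge, times the factor [expR 1] that counts it as a back edge. *)
pose a : R := p / (1 - p) * expR 1.
have p1 : 1 - p != 0 by lra.
have a0 : 0 <= a by rewrite mulr_ge0 ?expR_ge0// divr_ge0; lra.
have TF F : T F \subset F by apply: tree_edges_sub (nf F).
have weight_split (F : {set {set G}}) : F \subset E -> subset_weight p E F * expR #|F :\: T F|%:R
    = subset_weight p E (T F) * a ^+ #|F :\: T F|.
  move=> FE; have TE := subset_trans (TF F) FE.
  rewrite !subset_weightE// cardsD (setIidPr (TF F)).
  have := subset_leq_card FE; have := subset_leq_card (TF F).
  move: #|T F| #|F| #|E| => t f m tf fm.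
  rewrite -[(f - t)%:R]mulr1 expRM_natl exprMn expr_div_n.
  have -> : (m - t = (m - f) + (f - t))%N by lia.
  have {1}-> : (f = t + (f - t))%N by lia.
  rewrite !exprD; field; exact: expf_neq0.
apply: (@le_trans _ _ (expR (- x) * \sum_(F in powerset E | bad F)
    subset_weight p E (T F) * a ^+ #|F :\: T F|)).
  rewrite /expectation big_mkcondr big_distrr /=; apply: ler_sum => F.
  rewrite inE => FE; rewrite -/(bad F); case: ifP => [bF|_].
    rewrite -weight_split// mulr1 mulrCA -expRD ler_peMr ?subset_weight_ge0//.
    rewrite -[leLHS]expR0 ler_expR addrC subr_ge0.
    case/andP: bF => _ /le_trans; apply; apply: (excess_le_back_edges R (nf F)).
  by rewrite !mulr0.
have -> : 2 * p * expR 1 * sigma - x = - x + 2 * p * expR 1 * sigma by ring.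
rewrite expRD ler_pM2l ?expR_gt0//.
rewrite (partition_big T (fun T0 => T0 \in powerset E)) /=; last first.
  by move=> F /andP[]; rewrite !inE => FE _; apply: subset_trans (TF F) FE.
have := expectation_cst p E 1; rewrite /expectation => total.
rewrite -[leRHS]mul1r -[X in _ <= X * _]total big_distrl /=.
apply: ler_sum => T0; rewrite inE => T0E; rewrite mulr1.
pose A := [set F | [&& F \in powerset E, bad F & T F == T0]].
have -> : \sum_(F | (F \in powerset E) && bad F && (T F == T0))
    subset_weight p E (T F) * a ^+ #|F :\: T F| =
    subset_weight p E T0 * \sum_(F in A) a ^+ #|F :\: T0|.
  rewrite big_distrr /=; apply: eq_big => [F|F]; first by rewrite [in RHS]inE andbA.
  by move=> /andP[_ /eqP->].
rewrite ler_wpM2l ?subset_weight_ge0//.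
have [A0|[F0 F0A]] := set_0Vmem A.
  by rewrite A0 big_set0 expR_ge0.
have T0_sub F : F \in A -> T0 \subset F.
  by rewrite inE => /and3P[_ _ /eqP <-].
have injD : {in A &, injective (fun F => F :\: T0)}.
  move=> F F' /T0_sub sF /T0_sub sF' eFF'.
  by rewrite -(setID F T0) -(setID F' T0) (setIidPr sF) (setIidPr sF') eFF'.
rewrite -(big_imset (fun X : {set {set G}} => a ^+ #|X|) injD) /=.
set S := short_edges (anc F0) l.
have AS : [set F :\: T0 | F in A] \subset powerset S.
  apply/subsetP => X /imsetP[F]; rewrite inE => /and3P[FE /andP[bF _] /eqP TFE] ->.
  (* Rooted forests with the same edges coincide, so all [F] in [A] share the set [S] of short
     edges. *)
  have ancE : anc F = anc F0.
    apply/funext/tree_edges_inj; [exact: nf | exact: nf |].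
    by move: F0A; rewrite inE -TFE => /and3P[_ _ /eqP/esym].
  rewrite inE in FE; rewrite inE /S -ancE -TFE.
  by apply: back_edges_short => //; apply/asboolP.
apply: (@le_trans _ _ (\sum_(X in powerset S) a ^+ #|X|)).
  rewrite [leRHS](big_setID [set F :\: T0 | F in A]) /= (setIidPr AS) lerDl.
  by apply: sumr_ge0 => X _; apply: exprn_ge0.
rewrite sum_powerset_expr//.
apply: (@le_trans _ _ (expR (#|S|%:R * a))).
  rewrite expRM_natl; apply: lerXn2r; rewrite ?nnegrE ?expR_ge0 ?expR_ge1Dx//.
  by rewrite addr_ge0.
rewrite ler_expR; apply: (@le_trans _ _ (sigma * a)).
  by apply: ler_wpM2r => //; apply: short; apply: nf.
have s0 : 0 <= sigma by apply: le_trans (short (nf F0)); rewrite ler0n.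
(* Here [p / (1 - p) <= 2 * p], as [p <= 1 / 2]. *)
rewrite mulrC ler_wpM2r// ler_wpM2r ?expR_ge0//.
by rewrite ler_pdivrMr; nra.
Qed.

End NoLongCycle.

(** * Local sparsity *)

Section LocalSparsity.
Variable G : sgraph.
Implicit Types S : {set G}.

Section Induced.
Variable S : {set G}.

Definition induced_adj : rel {x : G | x \in S} := fun x y => adj (val x) (val y).

Lemma induced_adj_sym : symmetric induced_adj.
Proof. by move=> x y; apply: adj_sym. Qed.

Lemma induced_adj_irrefl : irreflexive induced_adj.
Proof. by move=> x; apply: adj_irrefl. Qed.

Definition induced : sgraph := SGraph induced_adj_sym induced_adj_irrefl.

Lemma card_induced : #|induced| = #|S|.
Proof. by rewrite card_sig; apply: eq_card. Qed.

Lemma degree_induced : (\sum_(x : induced) degree x = degree_sum S)%N.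
Proof.
rewrite /degree_sum (big_sub _ (degree_in S)); apply: eq_bigr => x _.
rewrite /degree /degree_in -(card_imset _ val_inj); apply: eq_card => y.
apply/imsetP/idP => [[z]|]; first by rewrite !inE => xz ->; rewrite (valP z).
by rewrite inE => /andP[yS xy]; exists (Sub y yS); rewrite ?inE.
Qed.

Lemma graph_free_induced HH : graph_free HH G -> graph_free HH induced.
Proof.
move=> free H HHH [f finj fadj]; apply: (free H HHH).
by exists (fun x => val (f x)) => //; apply: inj_comp val_inj finj.
Qed.

End Induced.

Lemma degree_sum_lt_n_free (R : realType) HH (d : R) S :
    graph_free HH G -> (0 < #|S| < n_free HH d)%N ->
  (degree_sum S)%:R < d * #|S|%:R.
Proof.
move=> free /andP[S0 Sl]; rewrite ltNge; apply/negP => dS.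
have : dense_free_order HH d #|S|.
  exists (induced S); split; [exact: card_induced | exact: S0 | |].
    exact: graph_free_induced.
  by rewrite /average_degree card_induced degree_induced ler_pdivlMr ?ltr0n.
by case/n_freeP => _; rewrite leqNgt Sl.
Qed.

(** Removing a vertex costs twice its degree, and the minimum degree is at most the average. *)
Lemma degree_sum_remove S : (0 < #|S|)%N ->
  exists2 x, x \in S &
    (degree_sum S * (#|S| - 2) <= degree_sum (S :\ x) * #|S|)%N.
Proof.
rewrite card_gt0 => /set0Pn[x0 x0S].
have [x /= xS xmin] := @arg_minnP _ x0 [pred z | z \in S] (degree_in S) x0S.
exists x => //.
have sum_x : (degree_sum S = degree_sum (S :\ x) + (degree_in S x).*2)%N.
  rewrite {1}/degree_sum (big_setD1 x xS) /= -addnn addnA addnC; congr addn.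
  transitivity (\sum_(z in S :\ x) (degree_in (S :\ x) z + adj z x))%N.
    apply: eq_bigr => z _; rewrite /degree_in (cardsD1 x) addnC !inE xS /=.
    congr addn; apply: eq_card => y; rewrite !inE.
    by case: (y == x); rewrite ?andbF.
  rewrite big_split /=; congr addn; rewrite -big_mkcondr /= sum1_card.
  apply: eq_card => z; rewrite inE unfold_in !inE adj_sym.
  by case: eqVneq => [->|_]; rewrite /= ?adj_irrefl ?andbF.
have min_x : (#|S| * degree_in S x <= degree_sum S)%N.
  by rewrite -sum_nat_const; apply: leq_sum.
move: sum_x min_x; rewrite -muln2.
move: (degree_sum S) (degree_sum _) (degree_in _ _) #|S| => a b c s; clear; nia.
Qed.

(* Removing a vertex of minimum degree does not decrease the ratio of
   [degree_sum S] to [#|S| * #|S|.-1]. *)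
Lemma degree_sum_dense_subset S t : (1 < t <= #|S|)%N ->
  exists2 S' : {set G}, #|S'| = t &
    (degree_sum S * (t * t.-1) <= degree_sum S' * (#|S| * #|S|.-1))%N.
Proof.
have [n] := ubnP #|S|; elim: n S => // n IH S ltn /andP[t1 tS].
have [->|neq] := eqVneq t #|S|; first by exists S.
have S0 : (0 < #|S|)%N by lia.
have [x xS remx] := degree_sum_remove S0.
have cardS : #|S| = #|S :\ x|.+1 by rewrite (cardsD1 x) xS.
have tx : (1 < t <= #|S :\ x|)%N by move: t1 tS neq; rewrite cardS; clear; lia.
have [|S' cS' dS'] := IH (S :\ x) _ tx; first by rewrite -cardS -ltnS.
exists S' => //; move: remx dS' tx; rewrite cardS.
move: (degree_sum S) (degree_sum S') (degree_sum (S :\ x)) #|S :\ x| => a b c s.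
move=> h1 h2 /andP[ht hs]; clear -h1 h2 ht hs.
rewrite -(@leq_pmul2r s.-1); last lia.
case: s h1 h2 hs => [|[|s]]; [lia|lia|] => h1 h2 hs.
rewrite /= in h1 h2 *.
have -> : (a * (t * t.-1) * s.+1 = (a * (s.+3 - 2)) * (t * t.-1))%N.
  by rewrite subSS subSS subn0; ring.
apply: (@leq_trans ((c * s.+3) * (t * t.-1))); first by rewrite leq_mul2r h1 orbT.
have -> : (c * s.+3 * (t * t.-1) = (c * (t * t.-1)) * s.+3)%N by ring.
apply: (@leq_trans ((b * (s.+2 * s.+1)) * s.+3)); first by rewrite leq_mul2r h2 orbT.
by rewrite leq_eqVlt; apply/orP; left; apply/eqP; ring.
Qed.

(** With [l = n_free HH d], a larger [S] has a subset of [l - 1] vertices that is nearly as dense,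
    yet too small to have average degree [d]. The loss [(#|S| - 1) / (l - 2)] is at most 4, since
    [3 * l - 1 <= 4 * (l - 2)] for [l >= 7]. *)
Lemma sparse_n_free (R : realType) HH (d : R) S :
    graph_free HH G -> 0 <= d -> (7 <= n_free HH d)%N ->
    (#|S| <= 3 * n_free HH d)%N ->
  (degree_sum S)%:R <= 4 * d * #|S|%:R.
Proof.
move=> free d0; set l := n_free HH d => l7 S3l.
have [S0|Spos] := posnP #|S|.
  have -> : degree_sum S = 0%N.
    by rewrite /degree_sum (cards0_eq S0) big_set0.
  by rewrite S0 mulr0.
have [ltSl|leSl] := ltnP #|S| l.
  apply: (@le_trans _ _ (d * #|S|%:R)).
    by apply/ltW/(@degree_sum_lt_n_free R HH); rewrite ?Spos.
  by rewrite -mulrA ler_peMl ?mulr_ge0//; lra.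
have tS : (1 < l.-1 <= #|S|)%N by lia.
have [S' cS' dS'] := degree_sum_dense_subset tS.
have : (degree_sum S')%:R < d * #|S'|%:R.
  by apply: (@degree_sum_lt_n_free R HH) => //; rewrite cS' -/l; lia.
rewrite cS' => ltS'.
move: dS'; rewrite -(ler_nat R) !natrM => dS'.
have t0 : 0 < l.-1%:R * l.-1.-1%:R :> R by rewrite -natrM ltr0n muln_gt0; lia.
rewrite -(ler_pM2r t0); apply: le_trans dS' _.
apply: (@le_trans _ _ (d * l.-1%:R * (#|S|%:R * #|S|.-1%:R))).
  by rewrite ler_wpM2r ?mulr_ge0//; apply: ltW.
have -> : d * l.-1%:R * (#|S|%:R * #|S|.-1%:R) =
    d * l.-1%:R * #|S|%:R * #|S|.-1%:R :> R by ring.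
have -> : 4 * d * #|S|%:R * (l.-1%:R * l.-1.-1%:R) =
    d * l.-1%:R * #|S|%:R * (4 * l.-1.-1%:R) :> R by ring.
rewrite ler_wpM2l ?mulr_ge0// -natrM ler_nat; lia.
Qed.

End LocalSparsity.

(** Degrees in a simple graph on [n] vertices are at most [n - 1]. The hypothesis excludes the
    default value 0 of [n_free]. *)
Lemma n_free_gt (R : realType) HH (d : R) m :
  dense_free_order HH d m -> d + 1 <= (n_free HH d)%:R.
Proof.
move=> /n_freeP[[G [<- G0 _ dG]] _]; move: dG.
rewrite /average_degree ler_pdivlMr ?ltr0n// => dG.
have : (\sum_(x : G) degree x + #|G| <= #|G| * #|G|)%N.
  rewrite -[X in (_ + X <= _)%N]sum1_card -big_split /= -[leqRHS]sum_nat_const.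
  apply: leq_sum => x _; rewrite addn1 ltn_neqAle max_card andbT.
  rewrite /degree; apply/negP => /eqP cx.
  have : [set y | adj x y] = setT.
    by apply/eqP; rewrite eqEcard subsetT cardsT cx leqnn.
  by move/setP/(_ x); rewrite !inE adj_irrefl.
rewrite -(ler_nat R) natrD natrM => leGG.
have G0' : 0 < #|G|%:R :> R by rewrite ltr0n.
rewrite -(ler_pM2r G0'); lra.
Qed.

Lemma handshake_le (G : sgraph) : (\sum_(x : G) degree x <= 2 * #|edges G|)%N.
Proof.
have -> : (\sum_(x : G) degree x = #|[set u : G * G | adj u.1 u.2]|)%N.
  under eq_bigr => x _ do rewrite /degree -sum1_card.
  rewrite pair_big_dep /= sum1_card; apply: eq_card => u.
  by rewrite [RHS]inE; apply: in_set.
(* An ordered adjacent pair is recovered from its edge and one bit of orientation. *)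
pose f (u : G * G) := ([set u.1; u.2], (enum_rank u.1 < enum_rank u.2)%N).
have finj : {in [set u : G * G | adj u.1 u.2] &, injective f}.
  move=> [u v] [u' v']; rewrite !inE /= => uv _ [euv lt].
  have /set2P u'uv : u' \in [set u; v] by rewrite euv set21.
  have /set2P v'uv : v' \in [set u; v] by rewrite euv set22.
  have /set2P uu'v' : u \in [set u'; v'] by rewrite -euv set21.
  have /set2P vu'v' : v \in [set u'; v'] by rewrite -euv set22.
  have uNv : enum_rank u != enum_rank v :> nat.
    by apply: contraTN uv => /eqP/val_inj/enum_rank_inj->; rewrite adj_irrefl.
  case: uu'v' => [eu|eu]; case: vu'v' => [ev|ev]; subst => //.
  - by rewrite eqxx in uNv.
  - by move: lt uNv; case: ltngtP.
  - by rewrite eqxx in uNv.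
rewrite -(card_in_imset finj) mulnC -card_bool -cardsT -cardsX.
apply: subset_leq_card; apply/subsetP => _ /imsetP[u uG ->].
by rewrite !inE andbT; apply/imsetP; exists u.
Qed.

Lemma min_degree_edges (G : sgraph) k : min_degree_ge G k ->
  (k * #|G| <= 2 * #|edges G|)%N.
Proof.
move=> [_ degk]; apply: leq_trans (handshake_le G).
by rewrite mulnC -sum_nat_const; apply: leq_sum => x _; apply: degk.
Qed.

Lemma min_degree_order (G : sgraph) k : min_degree_ge G k -> (k <= #|G|)%N.
Proof.
move=> [/card_gt0P[x _] degk]; apply: leq_trans (degk x) _.
exact: max_card.
Qed.

Lemma prob_percolationE (R : realType) (G : sgraph) (p : R) P :
  prob_percolation G p P =
    expectation p (edges G) (fun F => `[< P (spanning_subgraph F) >]%:R).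
Proof.
rewrite /prob_percolation big_mkcondr; apply: eq_bigr => F _.
by rewrite mulr_natr mulrb.
Qed.

Lemma has_cycle_geW (G : sgraph) (F F' : {set {set G}}) l : F \subset F' ->
  has_cycle_ge l (spanning_subgraph F) -> has_cycle_ge l (spanning_subgraph F').
Proof.
move=> sF [c [/andP[cyc unc] c3] lc]; exists c => //; split=> //.
by apply/andP; split=> //; apply: (sub_cycle (spanning_adjW sF) cyc).
Qed.

(** * Mean and concentration of the excess at [p = (1 + e) / k] *)

Section Supercritical.
Variables (R : realType) (e : R) (K k : nat) (G : sgraph).
Hypothesis e01 : 0 < e <= 1.
Hypothesis K_large : 800 / e ^+ 3 <= K%:R.
Hypothesis k_large : 8 * K%:R / e <= k%:R.
Hypothesis k_large2 : 100 / e ^+ 2 <= k%:R.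
Hypothesis degk : min_degree_ge G k.

Let p : R := (1 + e) / k%:R.

Lemma k_gt0 : 0 < k%:R :> R.
Proof.
by apply: lt_le_trans k_large2; rewrite divr_gt0// exprn_gt0//; case/andP: e01.
Qed.

(** As [K <= e * k / 8], the mean number of new neighbours is still at least [1 + e / 4], and
    survival probability [e / 5] is small enough to be sustained by it. *)
Lemma survival_inequality :
  (1 - (1 + e / 2) / k%:R * (e / 5)) ^+ (k - K) <= 1 - e / 5.
Proof.
have /andP[e0 e1] := e01; have k0 := k_gt0.
have K0 : 0 <= K%:R :> R by rewrite ler0n.
have Kk : K%:R <= e / 8 * k%:R.
  by move: k_large; rewrite ler_pdivrMr// => h; lra.
have leKk : (K <= k)%N by rewrite -(ler_nat R); nra.
have q0 : 0 <= 1 - (1 + e / 2) / k%:R * (e / 5).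
  have : (1 + e / 2) / k%:R <= 2.
    rewrite ler_pdivrMr//; have : 100 / e ^+ 2 >= 100.
      by rewrite ler_pdivlMr ?exprn_gt0// ler_piMr// exprn_ile1// ltW.
    by move: k_large2; nra.
  have : 0 <= (1 + e / 2) / k%:R by rewrite divr_ge0; lra.
  nra.
pose y := (1 + e / 4) * (e / 5).
have y0 : 0 <= y by rewrite /y; nra.
apply: (@le_trans _ _ (expR (- y))).
  apply: (@le_trans _ _ (expR (- ((1 + e / 2) / k%:R * (e / 5))) ^+ (k - K))).
    by apply: lerXn2r; rewrite ?nnegrE ?expR_ge0 ?expR_ge1Dx.
  rewrite -expRM_natl ler_expR mulrN lerN2 natrB//.
  have h : 1 + e / 4 <= (k%:R - K%:R) * ((1 + e / 2) / k%:R).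
    by rewrite mulrA ler_pdivlMr//; nra.
  have e5 : 0 <= e / 5 by lra.
  by rewrite [leRHS]mulrA; apply: ler_wpM2r e5 _ _ h.
rewrite expRN; apply: (@le_trans _ _ (1 + y)^-1).
  by rewrite lef_pV2 ?posrE ?expR_gt0 ?expR_ge1Dx//; lra.
by rewrite -div1r ler_pdivrMr /y; nra.
Qed.

Lemma expectation_excess_ge :
  e ^+ 3 / 400 * (p * #|edges G|%:R) <= expectation p (edges G) (@excess R G).
Proof.
have /andP[e0 e1] := e01; have k0 := k_gt0.
have e2 : 0 < e ^+ 2 by rewrite exprn_gt0.
have e3 : 0 < e ^+ 3 by rewrite exprn_gt0.
have k100 : 100 <= k%:R * e ^+ 2 by rewrite -ler_pdivrMr.
have K800 : 800 <= K%:R * e ^+ 3 by rewrite -ler_pdivrMr.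
have e2le1 : e ^+ 2 <= 1 by rewrite exprn_ile1// ltW.
have k100' : 100 <= k%:R :> R by nra.
have K0' : 0 < K%:R :> R.
  have : 0 < K%:R * e ^+ 3 by lra.
  by rewrite pmulr_lgt0.
have K0 : (0 < K)%N by rewrite -(ltr0n R).
pose p1 : R := (1 + e / 2) / k%:R.
have p1k : p1 * k%:R = 1 + e / 2 by rewrite /p1 divfK ?gt_eqF.
have pk : p * k%:R = 1 + e by rewrite /p divfK ?gt_eqF.
have p1_le : p1 <= e ^+ 2 / 50.
  rewrite -(ler_pM2r k0) p1k; nra.
have p10 : 0 <= p1 by rewrite divr_ge0; lra.
have p1_01 : 0 <= p1 <= 1 by lra.
have pp1 : p1 <= p by rewrite -(ler_pM2r k0) p1k pk; lra.
have ple1 : p <= 1 by rewrite -(ler_pM2r k0) pk mul1r; lra.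
(* The density of the second round that completes [p1] to [p]; it is at least [p * e / 4]. *)
pose p2 := (p - p1) / (1 - p1).
have p2_01 : 0 <= p2 <= 1.
  by rewrite divr_ge0/= ?ler_pdivrMr; lra.
have p2_ge : p * e / 4 <= p2.
  rewrite ler_pdivlMr; last lra.
  have : p * e / 4 <= p - p1.
    rewrite -(ler_pM2r k0) mulrBl pk p1k.
    have -> : p * e / 4 * k%:R = (p * k%:R) * e / 4 by ring.
    rewrite pk; nra.
  have : 0 <= p * e / 4 * p1 by rewrite !mulr_ge0//; lra.
  lra.
have s01 : 0 <= e / 5 <= 1 by lra.
have := expectation_excess p1_01 s01 survival_inequality (proj2 degk) p2_01 K0.
have -> : 1 - (1 - p1) * (1 - p2) = p.
  by rewrite /p2; field; rewrite subr_eq0 eq_sym lt_eqF//; lra.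
apply: le_trans.
set m := #|edges G|%:R.
have m0 : 0 <= m by rewrite ler0n.
have kn : k%:R * #|G|%:R <= 2 * m.
  by rewrite -!natrM ler_nat min_degree_edges.
(* The choice of [K] makes the loss at most half of the gain [e ^+ 3 / 200 * (p * m)] shown
   below. *)
have nK : #|G|%:R / K%:R <= e ^+ 3 / 400 * (p * m).
  rewrite ler_pdivrMr// -(ler_pM2l k0); apply: le_trans kn _.
  have -> : k%:R * (e ^+ 3 / 400 * (p * m) * K%:R) =
    (K%:R * e ^+ 3) * (p * k%:R) * m / 400 by ring.
  rewrite pk.
  have : 800 <= K%:R * e ^+ 3 * (1 + e) by nra.
  nra.
have : p * e / 4 * (e ^+ 2 / 50 * m) <= p2 * (((e / 5) ^+ 2 - p1) * m).
  apply: ler_pM => //; [by rewrite !mulr_ge0//; lra | by rewrite mulr_ge0//; lra |].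
  apply: ler_wpM2r => //; rewrite expr_div_n; lra.
have -> : p * e / 4 * (e ^+ 2 / 50 * m) = 2 * (e ^+ 3 / 400 * (p * m)) by field.
lra.
Qed.

End Supercritical.

Lemma prob_excess_small (R : realType) (G : sgraph) (p c : R) :
    0 <= p <= 1 -> 0 <= c ->
    c * (p * #|edges G|%:R) <= expectation p (edges G) (@excess R G) ->
  expectation p (edges G)
      (fun F => (excess R F < c * (p * #|edges G|%:R) / 2)%R%:R)
    <= expR (- (c ^+ 2 / 16 * (p * #|edges G|%:R))).
Proof.
(* This [t] minimizes the Chernoff exponent [t ^+ 2 * X - t * (c * X / 2)]. *)
move=> p01 c0; set X := p * _ => cX; pose t := c / 4.
have t0 : 0 <= t by rewrite divr_ge0.
have X0 : 0 <= X by rewrite mulr_ge0//; case/andP: p01.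
apply: (@le_trans _ _ (expectation p (edges G)
    (fun F => expR (t * (c * X / 2)) * expR (- (t * excess R F))))).
  apply: ler_expectation => // F _; rewrite -expRD; case: ltP => ltF.
    rewrite -[leLHS]expR0 ler_expR subr_ge0; apply: ler_wpM2l => //; exact: ltW.
  exact: expR_ge0.
rewrite expectationZ.
have := @laplace_lipschitz R _ p (edges G) (@excess R G) t p01 t0
  (@excess_lipschitz R G).
rewrite -(ler_pM2l (expR_gt0 (t * (c * X / 2)))) => /le_trans; apply.
rewrite -expRD ler_expR -/X.
have : t * (c * X) <= t * expectation p (edges G) (@excess R G).
  exact: ler_wpM2l.
have -> : t ^+ 2 * X = c ^+ 2 / 16 * X by rewrite /t; field.
have -> : t * (c * X) = c ^+ 2 / 4 * X by rewrite /t; field.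
have -> : t * (c * X / 2) = c ^+ 2 / 8 * X by rewrite /t; field.
lra.
Qed.

Theorem theorem1p1 (R : realType) (eps : R) (eps_gt0 : 0 < eps) :
  exists (delta : R) (k0 : nat), 0 < delta /\
    forall (k : nat) (HH : seq sgraph) (G : sgraph) (p : R),
      (k0 <= k)%N ->
      good_family HH ->
      graph_free HH G ->
      min_degree_ge G k ->
      0 <= p <= 1 ->
      (1 + eps) / k%:R <= p ->
      1 - expR (- (delta * k%:R))
        <= prob_percolation G p (has_cycle_ge (n_free HH (delta * k%:R))).
Proof.
have [e /andP[e0 e1] e_eps] : exists2 e : R, 0 < e <= 1 & e <= eps.
  exists (Num.min eps 1); last by rewrite ge_min lexx.
  by rewrite lt_min eps_gt0 ltr01 ge_min lexx orbT.
have nat_above (x : R) : exists n : nat, x <= n%:R.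
  exists (Num.bound `|x|); apply: le_trans (ler_norm x) _.
  exact/ltW/archi_boundP/normr_ge0.
pose c : R := e ^+ 3 / 400.
have e3 : 0 < e ^+ 3 by rewrite exprn_gt0.
have e3_1 : e ^+ 3 <= 1 by rewrite exprn_ile1// ltW.
have c0 : 0 < c by rewrite /c; lra.
have c1 : c <= 1 by rewrite /c; lra.
have c2_0 : 0 < c ^+ 2 by rewrite exprn_gt0.
have c2_1 : c ^+ 2 <= c by rewrite expr2 ger_pMr.
(* The first bound keeps the mean contribution of short edges below [c * (p * m) / 4], half the
   excess threshold; the second makes [delta * k] at most half the exponent of [b] below. *)
pose delta : R := Num.min (c / (192 * expR 1)) (c ^+ 2 / 64).
have E0 := expR_gt0 (1 : R).
have delta0 : 0 < delta.
  rewrite lt_min; apply/andP; split; last lra.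
  by apply: divr_gt0 => //; lra.
have delta_le1 : delta * (192 * expR 1) <= c.
  by rewrite -ler_pdivlMr ?ge_min ?lexx//; lra.
have delta_le2 : delta <= c ^+ 2 / 64 by rewrite ge_min lexx orbT.
have [K K_large] := nat_above (800 / e ^+ 3).
have [k1 k1P] := nat_above (8 * K%:R / e).
have [k2 k2P] := nat_above (100 / e ^+ 2).
have [k3 k3P] := nat_above (6 / delta).
have [k4 k4P] := nat_above (64 / c ^+ 2).
(* [k1] and [k2] serve the mean excess, [k3] gives [6 <= delta * k] and hence [7 <= l], [k4] absorbs
   a factor 2 at the end, and 4 ensures [p <= 1 / 2]. *)
exists delta, (maxn k1 (maxn k2 (maxn k3 (maxn k4 4)))); split=> //.
move=> k HH G p'; rewrite !geq_max => /and5P[].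
rewrite -!(ler_nat R) => /(le_trans k1P) kP1 /(le_trans k2P) kP2.
move=> /(le_trans k3P) kP3 /(le_trans k4P) kP4 kP5 _ free degk p'01 p'_ge.
have k0 : 0 < k%:R :> R by lra.
have e01 : 0 < e <= 1 by rewrite e0.
pose p : R := (1 + e) / k%:R.
have pk : p * k%:R = 1 + e by rewrite /p divfK ?gt_eqF.
have pp' : p <= p'.
  apply: le_trans p'_ge; rewrite /p ler_pM2r ?invr_gt0//; lra.
have p_half : 0 <= p <= 1 / 2.
  rewrite divr_ge0/=; [|lra|lra].
  by rewrite ler_pdivrMr//; lra.
have p01 : 0 <= p <= 1 by lra.
set d := delta * k%:R; set l := n_free HH d.
have d6 : 6 <= d by rewrite /d mulrC -ler_pdivrMr.
have [n0 _] := degk.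
(* [G] itself shows that [n_free] does not take its default value. *)
have dense : dense_free_order HH d #|G|.
  exists G; split=> //; rewrite /average_degree ler_pdivlMr ?ltr0n//.
  apply: (@le_trans _ _ (k%:R * #|G|%:R)).
    by rewrite /d ler_wpM2r// ger_pMl//; lra.
  rewrite -natrM ler_nat mulnC -sum_nat_const; apply: leq_sum => x _.
  exact: degk.2.
have l7 : (7 <= l)%N.
  by rewrite -(ler_nat R); have := n_free_gt dense; rewrite -/l; lra.
set m : R := #|edges G|%:R.
have kn : k%:R * #|G|%:R <= 2 * m.
  by rewrite -!natrM ler_nat min_degree_edges.
have kG : k%:R <= #|G|%:R :> R by rewrite ler_nat min_degree_order.
have m0 : 0 <= m by rewrite ler0n.
(* This turns exponents in [p * m] into exponents in [k]. *)
have pmk : k%:R <= 2 * (p * m).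
  have -> : 2 * (p * m) = p * (2 * m) by ring.
  apply: le_trans (_ : p * (k%:R * #|G|%:R) <= _).
    rewrite mulrA pk; have : 0 <= #|G|%:R * e by rewrite mulr_ge0// ltW.
    lra.
  by apply: ler_wpM2l => //; case/andP: p01.
have excess_ge := expectation_excess_ge e01 K_large kP1 kP2 degk.
rewrite -/p -/c -/m in excess_ge.
have small := prob_excess_small p01 (ltW c0) excess_ge.
rewrite -/m in small.
have short anc : rooted_forest anc -> #|short_edges (G := G) anc l|%:R <= 24 * delta * m.
  move=> forest; have sparse S := @sparse_n_free G R HH d S free.
  have l0 : (0 < l)%N by apply: leq_trans l7.
  apply: le_trans (card_short_edges forest l0 (B := 4 * d) _) _.
    by move=> S; apply: sparse => //; lra.
  have : delta * (k%:R * #|G|%:R) <= delta * (2 * m).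
    by apply: ler_wpM2l => //; exact: ltW.
  rewrite /d; lra.
have nocycle := prob_no_long_cycle (c * (p * m) / 2) p_half short.
set E := edges G in small nocycle excess_ge *.
pose cyc (F : {set {set G}}) := `[< has_cycle_ge l (spanning_subgraph F) >].
rewrite prob_percolationE.
(* Long cycles persist when edges are added, so [p'] may be lowered to [p]. *)
apply: (@le_trans _ _ (expectation p E (fun F => (cyc F)%:R))); last first.
  apply: expectation_monotone; [lra | by case/andP: p'01 |].
  move=> F F' sF _; rewrite ler_nat /cyc; case: asboolP => // cF.
  by rewrite asboolT//; apply: has_cycle_geW cF.
(* Without a long cycle, the excess is either below or above half of its lower bound in mean. *)
have total : 1 <= expectation p E (fun F => (cyc F)%:R) +
    (expectation p E (fun F => (excess R F < c * (p * m) / 2)%R%:R) +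
     expectation p E (fun F =>
       (`[< ~ has_cycle_ge l (spanning_subgraph F) >] &&
         (c * (p * m) / 2 <= excess R F))%:R)).
  rewrite -[leLHS](expectation_cst p E) -!expectationD.
  apply: ler_expectation => // F _; rewrite /cyc asbool_neg -!natrD ler1n.
  by case: (`[< _ >]) => //=; case: ltP.
pose Y := p * m.
rewrite -/Y in small nocycle total pmk.
have Y0 : 0 <= Y by lra.
pose b := expR (- (c ^+ 2 / 32 * k%:R)).
have small_b : expR (- (c ^+ 2 / 16 * Y)) <= b.
  rewrite ler_expR lerN2.
  have -> : c ^+ 2 / 16 * Y = c ^+ 2 / 32 * (2 * Y) by field.
  by apply: ler_wpM2l => //; lra.
have nocycle_b : expR (2 * p * expR 1 * (24 * delta * m) - c * Y / 2) <= b.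
  rewrite ler_expR.
  have -> : 2 * p * expR 1 * (24 * delta * m) = delta * (192 * expR 1) * Y / 4.
    by rewrite /Y; field.
  have h1 := ler_wpM2r Y0 delta_le1.
  have h2 := ler_wpM2r Y0 c2_1.
  have h3 : c ^+ 2 * k%:R <= c ^+ 2 * (2 * Y) by apply: ler_wpM2l => //; exact: ltW.
  have h4 : 0 <= c * Y by apply: mulr_ge0 => //; exact: ltW.
  lra.
(* The spare exponent is at least [c ^+ 2 / 64 * k >= 1], and [expR 1 >= 2]. *)
have two_b : 2 * b <= expR (- d).
  have -> : - d = - (c ^+ 2 / 32 * k%:R) + (c ^+ 2 / 32 * k%:R - d) by ring.
  rewrite expRD -/b mulrC; apply: ler_wpM2l; first exact: expR_ge0.
  apply: le_trans (expR_ge1Dx _).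
  have h1 : d <= c ^+ 2 / 64 * k%:R by apply: ler_wpM2r => //; exact: ltW.
  have h2 : 64 <= k%:R * c ^+ 2 by rewrite -ler_pdivrMr.
  lra.
rewrite -/E -/m -/Y in small nocycle total *.
lra.
Qed.
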